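(* (a) For every $n\ge 1$ and every domain $D\subset\mathbb{C}^n$ one has $\kappa_D^{(2n-1)}=\hat\kappa_D$, i.e. $\kappa_D^{(2n-1)}(z;X)=\hat\kappa_D(z;X)$ for all $z\in D$ and $X\in\mathbb{C}^n$. (b) On the other hand, if $n\ge 2$ and $$D_n=\Big\{z\in\mathbb{C}^n:\ \sum_{j=2}^n\big(2|z_1^3-z_j^3|+|z_1^3+z_j^3|\big)<2(n-1)\Big\},$$ then $\kappa_{D_n}^{(2n-2)}(0;\cdot)\neq\hat\kappa_{D_n}(0;\cdot)$, i.e. these two functions on $\mathbb{C}^n$ are not identical.
   Context: Let $\mathbb{D}\subset\mathbb{C}$ be the open unit disc, and let $\mathcal{O}(\mathbb{D},D)$ denote the set of holomorphic maps from $\mathbb{D}$ to $D$. For a domain (nonempty connected open set) $D\subset\mathbb{C}^n$, the Kobayashi--Royden pseudometric is $$\kappa_D(z;X)=\inf\{\alpha\ge 0:\ \exists\varphi\in\mathcal{O}(\mathbb{D},D):\ \varphi(0)=z,\ \alpha\varphi'(0)=X\},\qquad z\in D,\ X\in\mathbb{C}^n.$$ For $m\in\mathbb{N}$, $m\ge1$, the $m$-th Kobayashi pseudometric of $D$ is $$\kappa_D^{(m)}(z;X)=\inf\Big\{\sum_{j=1}^m\kappa_D(z;X_j):\ X_1,\dots,X_m\in\mathbb{C}^n,\ \sum_{j=1}^mX_j=X\Big\}.$$ The Kobayashi--Buseman pseudometric $\hat\kappa_D$ of $D$ is defined by letting $\hat\kappa_D(z;\cdot)$ be the largest pseudonorm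 (seminorm) on $\mathbb{C}^n$ which does not exceed $\kappa_D(z;\cdot)$; equivalently, $$\hat\kappa_D(z;X)=\inf\Big\{\sum_{j=1}^m\kappa_D(z;X_j):\ m\in\mathbb{N},\ X_1,\dots,X_m\in\mathbb{C}^n,\ \sum_{j=1}^mX_j=X\Big\}.$$ *)

(* Defs.v *)
From HB Require Import structures.
From mathcomp Require Import all_boot all_order all_algebra.
From mathcomp Require Import complex.
From mathcomp Require Import all_classical all_reals all_analysis.

Set Implicit Arguments.
Unset Strict Implicit.
Unset Printing Implicit Defensive.

Import Order.TTheory GRing.Theory Num.Theory.
Import numFieldNormedType.Exports.

Local Open Scope classical_set_scope.
Local Open Scope ring_scope.

(* The complex numbers [R[i]], typed as a [numClosedFieldType] so that [Cplx R]
   and ['rV[Cplx R]_n] carry the library's normed topology with complex scalars;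
   [derivable] and [derive1] are then complex differentiability and the complex
   derivative. *)
Definition Cplx (R : realType) : numClosedFieldType := R[i].

Definition unit_disc (R : realType) : set (Cplx R) :=
  [set zeta | `|zeta| < 1].

Definition domain (R : realType) (n : nat) (D : set 'rV[Cplx R]_n) : Prop :=
  [/\ D !=set0, open D & connected D].

(* Maps are total; only their values on the (open) disc matter. *)
Definition holomorphic_disc (R : realType) (n : nat) (D : set 'rV[Cplx R]_n)
    (phi : Cplx R -> 'rV[Cplx R]_n) : Prop :=
  forall zeta, unit_disc zeta -> derivable phi zeta 1 /\ D (phi zeta).

(* [inf] is the real-valued infimum. For [D] open and [D z] the set below
   contains some alpha (take an affine disc), so the default value of [inf]
   on the empty set plays no role. *)
Definition kobayashi_royden (R : realType) (n : nat) (D : set 'rV[Cplx R]_n)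
    (z X : 'rV[Cplx R]_n) : R :=
  inf [set alpha : R | 0 <= alpha /\
    exists phi : Cplx R -> 'rV[Cplx R]_n,
      [/\ holomorphic_disc D phi, phi 0 = z
        & (alpha%:C%C : Cplx R) *: derive1 phi 0 = X]].

Definition kobayashi (R : realType) (n m : nat) (D : set 'rV[Cplx R]_n)
    (z X : 'rV[Cplx R]_n) : R :=
  inf [set \sum_(j < m) kobayashi_royden D z (Y j) |
    Y in [set Y : 'I_m -> 'rV[Cplx R]_n | \sum_(j < m) Y j = X]].

(* The modulus [`|a|] lives in [Cplx R]; [complex.Re `|a|] is its value in [R]. *)
Definition seminorm (R : realType) (n : nat) (p : 'rV[Cplx R]_n -> R) : Prop :=
  [/\ forall X : 'rV[Cplx R]_n, 0 <= p X,
      forall (a : Cplx R) (X : 'rV[Cplx R]_n),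
        p (a *: X) = complex.Re `|a| * p X
    & forall X Y : 'rV[Cplx R]_n, p (X + Y) <= p X + p Y].

Definition seminorm_below (R : realType) (n : nat) (D : set 'rV[Cplx R]_n)
    (z : 'rV[Cplx R]_n) : set ('rV[Cplx R]_n -> R) :=
  [set p | seminorm p /\ forall X, p X <= kobayashi_royden D z X].

(* The largest seminorm below [kobayashi_royden D z], as the pointwise supremum
   of all of them; see [kobayashi_buseman_largest]. *)
Definition kobayashi_buseman (R : realType) (n : nat) (D : set 'rV[Cplx R]_n)
    (z X : 'rV[Cplx R]_n) : R :=
  sup [set p X | p in seminorm_below D z].

Lemma kobayashi_royden_ge0 (R : realType) (n : nat) (D : set 'rV[Cplx R]_n)
  (z X : 'rV[Cplx R]_n) : 0 <= kobayashi_royden D z X.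
Proof.
rewrite /kobayashi_royden; set A := [set _ | _].
have [->|A0] := eqVneq A set0; first by rewrite inf0.
by apply: lb_le_inf; [exact/set0P|move=> a []].
Qed.

Lemma kobayashi_buseman_largest (R : realType) (n : nat)
    (D : set 'rV[Cplx R]_n) (z : 'rV[Cplx R]_n) :
  seminorm_below D z (kobayashi_buseman D z) /\
  (forall p, seminorm_below D z p ->
    forall X, p X <= kobayashi_buseman D z X).
Proof.
have s0 : seminorm_below D z (fun=> 0).
  split; first by split=> *; rewrite ?mulr0 ?addr0.
  by move=> X; exact: kobayashi_royden_ge0.
have ne X : [set p X | p in seminorm_below D z] !=set0 by exists 0, (fun=> 0).
have ub p X : seminorm_below D z p -> p X <= kobayashi_buseman D z X.
  move=> ps; apply: ub_le_sup; last by exists p.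
  by exists (kobayashi_royden D z X) => _ [q [_ qk] <-].
have lub X c : (forall p, seminorm_below D z p -> p X <= c) ->
    kobayashi_buseman D z X <= c.
  by move=> h; apply: ge_sup => // _ [p ps <-]; exact: h.
split; last by move=> p ps X; exact: ub.
split; last by move=> X; apply: lub => p [].
split.
- by move=> X; exact: (ub _ X s0).
- have hle (a : Cplx R) (X : 'rV[Cplx R]_n) :
      kobayashi_buseman D z (a *: X)
      <= complex.Re `|a| * kobayashi_buseman D z X.
    apply: lub => p ps; have [[_ pZ _] _] := ps.
    by rewrite pZ ler_wpM2l ?ub // normc_def /= sqrtr_ge0.
  move=> a X; apply/eqP; rewrite eq_le hle andTb.
  have [->|a0] := eqVneq a 0.
    have -> : complex.Re `|0 : Cplx R| = 0 by rewrite (@normr0 _ (Cplx R)).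
    by rewrite mul0r; exact: (ub _ _ s0).
  have ra : 0 < complex.Re `|a|.
    have : 0 < `|a| by rewrite normr_gt0.
    by rewrite ltcE => /andP[].
  rewrite -ler_pdivlMl //.
  have := hle a^-1 (a *: X); rewrite scalerA mulVf // scale1r.
  have normV : complex.Re `|a^-1| = (complex.Re `|a|)^-1.
    exact: (@ComplexField.Normc.normcV R a).
  by rewrite normV.
- move=> X Y; apply: lub => p ps; have [[_ _ pD] _] := ps.
  by apply: (le_trans (pD X Y)); rewrite lerD // ub.
Qed.

(* Lives in C^(n+1): the coordinate z_1 of the usual numbering is
   [z ord0 ord0], the other [n] coordinates have index [j != ord0], and the
   bound is 2((n+1)-1). *)
Definition Dn (R : realType) (n : nat) : set 'rV[Cplx R]_n.+1 :=
  [set z | \sum_(j < n.+1 | j != ord0)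
             (2 * `|z ord0 ord0 ^+ 3 - z ord0 j ^+ 3|
              + `|z ord0 ord0 ^+ 3 + z ord0 j ^+ 3|) < 2 * n%:R].

(* Main.v *)
Require Import Defs.
From mathcomp Require Import all_boot all_order all_algebra.
From mathcomp Require Import complex ring lra zify.
From mathcomp Require Import all_classical all_reals all_analysis.

Set Implicit Arguments.
Unset Strict Implicit.
Unset Printing Implicit Defensive.

Import Order.TTheory GRing.Theory Num.Theory.
Import numFieldNormedType.Exports.

Local Open Scope classical_set_scope.
Local Open Scope ring_scope.

(** Part (a).  Write [h] for the Kobayashi-Royden pseudometric at a point of
[D].  It satisfies [h (a *: X) = modulus a * h X], because a disc can be rotated
([kobayashi_royden_balanced]).  The [m]-th pseudometric is the cheapest cost
[\sum_j h (Y j)] of a decomposition of [X] into [m] vectors; it is a seminorm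
below [h], hence the largest one, as soon as every decomposition into more than
[m] vectors can be shortened to [m] vectors without raising the cost
([balanced_reduce]).  Caratheodory's argument does this for [m] equal to the real
dimension [2 * n].  Complex scalars save one more vector.  Among all
recombinations [\sum_j a j *: X j] with complex coefficients choose one of
minimal cost.  First-order optimality yields a complex linear form [l] with
[l (x j) = h (x j)] on its terms [x j]; these values being real, the terms lie in
a real hyperplane, of dimension [2 * n - 1], so that [2 * n] of them are linearly
dependent over the reals ([stationary_dependent]).  Moving along the dependency
keeps the cost and removes a vector.  A small multiple of a norm is added to [h]
beforehand, to make the cost coercive and a minimizer exist.

Part (b).  In [C^(n+1)] let [energy z] be the sum that defines [Dn]; it is
homogeneous of degree 3, and [Dn] is [energy < 2 * n].  A Schwarz lemma gives
[energy (phi'(0)) <= 2 * n] for the discs [phi] in [Dn] centred at [0]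
([energy_derive1_le]), so the Kobayashi-Royden metric at [0] is
[(energy / (2 * n)) ^ (1 / 3)].  From [2 |a - b| + |a + b| >= 2 |a|], with
equality only if [a = b], this metric is at least the modulus of the first entry,
with equality only on the multiples of the vertices, the vectors with first entry
[1] and all other entries cube roots of unity.  Hence for a positive combination
[X] of vertices the seminorm equals the first entry of [X], and a decomposition
of [X] that reaches this value consists of nonnegative multiples of vertices
([kobayashi_moment_point_gt]); the infimum over decompositions is attained by
compactness ([kobayashi_Dn_attained]).  The vertices span a real space of
dimension [2 * n + 1], so a generic positive combination of [2 * n + 1]
independent vertices is no combination of [2 * n] of them
([moment_point_generic]).

The Schwarz lemma is needed for maps that are complex differentiable at each
point, with no continuity of the derivative given.  It comes from a mean value
property: with [G] holomorphic on the punctured disc and [H = G \o exp], the mean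
of [Re H] over a vertical period does not depend on the abscissa.  This is the
vanishing of a flux through a rectangle, proved by Goursat's bisection
([flux_eq0]). *)

(** * Moduli of complex numbers as real numbers *)

Section Modulus.
Variable R : realType.
Implicit Types z w : Cplx R.

Definition modulus z : R := complex.Re `|z|.

Lemma modulusE z : (modulus z)%:C%C = `|z|.
Proof. by rewrite /modulus normc_def. Qed.

Lemma modulus_ge0 z : 0 <= modulus z.
Proof. by rewrite -(lecR 0) modulusE normr_ge0. Qed.

Lemma modulus0 : modulus 0 = 0.
Proof. by apply: (@complexI R); rewrite modulusE normr0. Qed.

Lemma modulus1 : modulus 1 = 1.
Proof. by apply: (@complexI R); rewrite modulusE normr1. Qed.

Lemma modulusM z w : modulus (z * w) = modulus z * modulus w.
Proof. by apply: (@complexI R); rewrite rmorphM/= !modulusE normrM. Qed.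

Lemma modulusX z n : modulus (z ^+ n) = modulus z ^+ n.
Proof. by apply: (@complexI R); rewrite rmorphXn/= !modulusE normrX. Qed.

Lemma modulusV z : modulus z^-1 = (modulus z)^-1.
Proof. by apply: (@complexI R); rewrite fmorphV/= !modulusE normfV. Qed.

Lemma modulusN z : modulus (- z) = modulus z.
Proof. by apply: (@complexI R); rewrite !modulusE normrN. Qed.

Lemma modulusC z w : modulus (z - w) = modulus (w - z).
Proof. by rewrite -modulusN opprB. Qed.

Lemma le_modulusD z w : modulus (z + w) <= modulus z + modulus w.
Proof. by rewrite -lecR rmorphD/= !modulusE ler_normD. Qed.

Lemma le_modulus_sum (I : Type) (r : seq I) (P : pred I) (F : I -> Cplx R) :
  modulus (\sum_(i <- r | P i) F i) <= \sum_(i <- r | P i) modulus (F i).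
Proof.
by rewrite -lecR rmorph_sum/= modulusE (le_trans (ler_norm_sum _ _ _)).
Qed.

Lemma modulus_eq0 z : (modulus z == 0) = (z == 0).
Proof. by rewrite -[RHS]normr_eq0 -modulusE -(inj_eq (@complexI R)). Qed.

Lemma modulus_gt0 z : (0 < modulus z) = (z != 0).
Proof. by rewrite lt0r modulus_ge0 modulus_eq0 andbT. Qed.

Lemma modulus_real (x : R) : modulus (x%:C%C : Cplx R) = `|x|.
Proof.
apply: (@complexI R); rewrite modulusE normc_def/=.
by rewrite expr0n/= addr0 sqrtr_sqr.
Qed.

Lemma modulus_nat k : modulus k%:R = k%:R.
Proof. by rewrite -(rmorph_nat (real_complex R)) modulus_real ger0_norm. Qed.

Lemma modulus_double z : modulus (z + z) = 2 * modulus z.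
Proof. by rewrite (_ : z + z = 2%:R * z) ?modulusM ?modulus_nat//; ring. Qed.

Lemma gt0_real_complex (e : Cplx R) : 0 < e -> exists2 r : R, 0 < r & e = r%:C%C.
Proof.
move=> e0; exists (complex.Re e); last by rewrite RRe_real// gtr0_real.
by move: e0; rewrite ltcE => /andP[].
Qed.

Lemma modulusRI (x y : R) : modulus (x +i* y)%C = Num.sqrt (x ^+ 2 + y ^+ 2).
Proof. by apply: (@complexI R); rewrite modulusE normc_def. Qed.

Lemma Re_le_modulus z : `|complex.Re z| <= modulus z.
Proof. by rewrite -lecR modulusE normc_ge_Re. Qed.

Lemma modulus_le (z : Cplx R) : modulus z <= `|complex.Re z| + `|complex.Im z|.
Proof.
case: z => x y; rewrite modulusRI/= -(@ler_pXn2r _ 2)// ?nnegrE ?sqrtr_ge0//.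
rewrite sqr_sqrtr ?addr_ge0 ?sqr_ge0// sqrrD !real_normK ?num_real//.
by rewrite lerD2r lerDl mulrn_wge0// mulr_ge0.
Qed.

Lemma Im_le_modulus z : `|complex.Im z| <= modulus z.
Proof.
case: z => x y; rewrite modulusRI/= -sqrtr_sqr ler_sqrt.
  by rewrite lerDr sqr_ge0.
by rewrite addr_ge0 ?sqr_ge0.
Qed.

Lemma ReDc z w : complex.Re (z + w) = complex.Re z + complex.Re w.
Proof. by case: z; case: w. Qed.

Lemma ImDc z w : complex.Im (z + w) = complex.Im z + complex.Im w.
Proof. by case: z; case: w. Qed.

Lemma ReBc z w : complex.Re (z - w) = complex.Re z - complex.Re w.
Proof. by case: z; case: w. Qed.

Lemma ImBc z w : complex.Im (z - w) = complex.Im z - complex.Im w.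
Proof. by case: z; case: w. Qed.

Lemma ReMc z w : complex.Re (z * w) =
  complex.Re z * complex.Re w - complex.Im z * complex.Im w.
Proof. by case: z; case: w. Qed.

Lemma ImMc z w : complex.Im (z * w) =
  complex.Re z * complex.Im w + complex.Im z * complex.Re w.
Proof. by case: z => a b; case: w => c d /=; rewrite addrC. Qed.

Lemma Re_sum (I : Type) (r : seq I) (P : pred I) (F : I -> Cplx R) :
  complex.Re (\sum_(i <- r | P i) F i) = \sum_(i <- r | P i) complex.Re (F i).
Proof. by apply: (big_morph _ ReDc). Qed.

Lemma Im_sum (I : Type) (r : seq I) (P : pred I) (F : I -> Cplx R) :
  complex.Im (\sum_(i <- r | P i) F i) = \sum_(i <- r | P i) complex.Im (F i).
Proof. by apply: (big_morph _ ImDc). Qed.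

End Modulus.

(** * Integrals of continuous functions over segments *)

Section SegmentIntegral.
Variable R : realType.
Implicit Types (a b m : R) (f g : R -> R).

Definition segint a b f : R := \int[@lebesgue_measure R]_(x in `[a, b]) f x.

Let itg a b f : {within `[a, b], continuous f} ->
  (@lebesgue_measure R).-integrable `[a, b] (EFin \o f).
Proof. by move=> cf; apply: continuous_compact_integrable => //; exact: segment_compact. Qed.

Lemma segint_split a m b f : a <= m -> m <= b ->
  {within `[a, b], continuous f} -> segint a b f = segint a m f + segint m b f.
Proof.
move=> am mb /itg itf; rewrite /segint.
have := @Rintegral_itvB R f (BLeft a) (BRight b) m itf.
rewrite !bnd_simp => /(_ am mb) /eqP; rewrite subr_eq => /eqP ->.
rewrite addrC Rintegral_itv_obnd_cbnd//.
apply: integrableS itf => //; apply: subset_itvr.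
by rewrite bnd_simp.
Qed.

Lemma segint_near a b f g (k e : R) : a <= b ->
  {within `[a, b], continuous f} -> {within `[a, b], continuous g} ->
  (forall x, a <= x <= b -> `|f x - g x - k| <= e) ->
  `|segint a b f - segint a b g - k * (b - a)| <= e * (b - a).
Proof.
move=> ab cf cg fgk.
have [itf itg'] := (itg cf, itg cg).
have ck (c : R) : segint a b (cst c) = c * (b - a).
  rewrite /segint Rintegral_cst//= lebesgue_measure_itv/= lte_fin.
  by case: ltrP => //= ba; rewrite (@le_anti _ _ a b) ?ab// subrr.
have itc (c : R) : (@lebesgue_measure R).-integrable `[a, b] (EFin \o (cst c)).
  by apply: itg => x; exact: cst_continuous.
have itB : (@lebesgue_measure R).-integrable `[a, b] (EFin \o (fun x => f x - g x)).
  by apply: itg => x; apply: continuousB; [exact: cf|exact: cg].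
have -> : segint a b f - segint a b g = segint a b (fun x => f x - g x).
  by rewrite /segint RintegralB.
rewrite ler_norml lerBrDr lerBlDr -mulNr -!mulrDl -!ck.
apply/andP; split; apply: le_Rintegral => // x /=; rewrite in_itv/= => /fgk.
  by rewrite ler_norml lerBrDr => /andP[].
by rewrite ler_norml lerBlDr => /andP[].
Qed.

End SegmentIntegral.

(** * Goursat's theorem for rectangles *)

Section Flux.
Variables (R : realType) (U V : R -> R -> R).

(** The outward flux of the field [(U, - V)] through the boundary of a rectangle,
which is the imaginary part of the contour integral of [U + i V]. *)
Definition flux a b c d : R :=
  segint c d (U b) - segint c d (U a) - (segint a b (V^~ d) - segint a b (V^~ c)).

Variables a0 b0 c0 d0 : R.
Hypothesis ab0 : a0 <= b0.
Hypothesis cd0 : c0 <= d0.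
Hypothesis contU : forall x, a0 <= x <= b0 -> {within `[c0, d0], continuous (U x)}.
Hypothesis contV : forall y, c0 <= y <= d0 -> {within `[a0, b0], continuous (V^~ y)}.

Let subseg (f : R -> R) a b a' b' : a <= a' -> b' <= b ->
  {within `[a, b], continuous f} -> {within `[a', b'], continuous f}.
Proof.
move=> aa bb; apply: continuous_subspaceW => x /=.
by rewrite !in_itv/= => /andP[? ?]; apply/andP; split; lra.
Qed.

Let flux_splitx a m b c d : a0 <= a -> a <= m -> m <= b -> b <= b0 ->
  c0 <= c -> c <= d -> d <= d0 -> flux a b c d = flux a m c d + flux m b c d.
Proof.
move=> a0a am mb bb0 c0c cd dd0; rewrite /flux.
rewrite (@segint_split _ a m b (V^~ d))// ?(@segint_split _ a m b (V^~ c))//.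
- by lra.
- by apply: (subseg a0a bb0); apply: contV; lra.
- by apply: (subseg a0a bb0); apply: contV; lra.
Qed.

Let flux_splity a b c m d : a0 <= a -> a <= b -> b <= b0 ->
  c0 <= c -> c <= m -> m <= d -> d <= d0 -> flux a b c d = flux a b c m + flux a b m d.
Proof.
move=> a0a ab bb0 c0c cm md dd0; rewrite /flux.
rewrite (@segint_split _ c m d (U a))// ?(@segint_split _ c m d (U b))//.
- by lra.
- by apply: (subseg c0c dd0); apply: contU; lra.
- by apply: (subseg c0c dd0); apply: contU; lra.
Qed.

(** Near a point where [U] and [V] are differentiable and the [x]-slope of [U]
equals the [y]-slope of [V], the two slopes cancel in the flux, so that only the
quadratically small contribution of the remainders is left. *)
Let flux_near x y p q r (e a c w h : R) :
  a0 <= a -> 0 <= w -> a + w <= b0 -> c0 <= c -> 0 <= h -> c + h <= d0 ->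
  (forall x' y', a <= x' <= a + w -> c <= y' <= c + h ->
    `|U x' y' - U x y - p * (x' - x) - q * (y' - y)| <= e * (w + h) /\
    `|V x' y' - V x y - r * (x' - x) - p * (y' - y)| <= e * (w + h)) ->
  `|flux a (a + w) c (c + h)| <= 2 * e * (w + h) ^+ 2.
Proof.
move=> a0a w0 ab0' c0c h0 cd0' De'.
have EU : `|segint c (c + h) (U (a + w)) - segint c (c + h) (U a) - (p * w) * h|
    <= (2 * e * (w + h)) * h.
  have := @segint_near R c (c + h) (U (a + w)) (U a) (p * w) (2 * e * (w + h)).
  rewrite (_ : c + h - c = h); last by rewrite addrAC subrr add0r.
  apply; first by rewrite lerDl.
  - by apply: (@subseg _ c0 d0); try lra; apply: contU; lra.
  - by apply: (@subseg _ c0 d0); try lra; apply: contU; lra.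
  move=> y' y'c.
  have [|//|D1 _] := De' (a + w) y'; first by rewrite lerDl w0/=.
  have [|//|D2 _] := De' a y'; first by rewrite lexx lerDl.
  by move: D1 D2; rewrite !ler_norml; lra.
have EV : `|segint a (a + w) (V^~ (c + h)) - segint a (a + w) (V^~ c) - (p * h) * w|
    <= (2 * e * (w + h)) * w.
  have := @segint_near R a (a + w) (V^~ (c + h)) (V^~ c) (p * h) (2 * e * (w + h)).
  rewrite (_ : a + w - a = w); last by rewrite addrAC subrr add0r.
  apply; first by rewrite lerDl.
  - by apply: (@subseg _ a0 b0); try lra; apply: contV; lra.
  - by apply: (@subseg _ a0 b0); try lra; apply: contV; lra.
  move=> x' x'a.
  have [//||_ D1] := De' x' (c + h); first by rewrite lerDl h0/=.
  have [//||_ D2] := De' x' c; first by rewrite lexx lerDl.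
  by move: D1 D2; rewrite !ler_norml; lra.
rewrite /flux expr2 mulrA [leRHS]mulrDr addrC.
by move: EU EV; rewrite !ler_norml; lra.
Qed.

Let box w h (p : R * R) : Prop :=
  [/\ a0 <= p.1, p.1 + w <= b0, c0 <= p.2 & p.2 + h <= d0].

Let flux_bisect (w h : R) (p : R * R) : 0 <= w -> 0 <= h -> box w h p ->
  exists q : R * R, [/\ p.1 <= q.1, q.1 + w / 2 <= p.1 + w,
    p.2 <= q.2, q.2 + h / 2 <= p.2 + h &
    `|flux p.1 (p.1 + w) p.2 (p.2 + h)| <=
      4 * `|flux q.1 (q.1 + w / 2) q.2 (q.2 + h / 2)|].
Proof.
case: p => a c /= w0 h0 [/= a0a ab c0c cd].
pose F i j := `|flux (a + i * (w / 2)) (a + i * (w / 2) + w / 2)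
  (c + j * (h / 2)) (c + j * (h / 2) + h / 2)|.
have E : `|flux a (a + w) c (c + h)| <= F 0 0 + F 0 1 + (F 1 0 + F 1 1).
  rewrite (@flux_splitx _ (a + w / 2))//; try lra.
  rewrite (@flux_splity a _ _ (c + h / 2))//; try lra.
  rewrite (@flux_splity (a + w / 2) _ _ (c + h / 2))//; try lra.
  rewrite (le_trans (ler_normD _ _))// lerD// (le_trans (ler_normD _ _))//.
    rewrite /F !mul0r !mul1r !addr0 -!addrA.
    by rewrite -(splitr h).
  rewrite /F !mul0r !mul1r !addr0 -!addrA.
  by rewrite -(splitr h) -(splitr w).
have [i [j [i0 j0 Fij]]] : exists i j, [/\ 0 <= i <= 1, 0 <= j <= 1 &
    `|flux a (a + w) c (c + h)| <= 4 * F i j].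
  apply: contrapT => H.
  have G i j : 0 <= i <= 1 -> 0 <= j <= 1 -> 4 * F i j < `|flux a (a + w) c (c + h)|.
    by move=> i01 j01; rewrite ltNge; apply/negP => K; apply: H; exists i, j.
  have := G 0 0; have := G 0 1; have := G 1 0; have := G 1 1.
  rewrite !lexx !ler01 => /(_ isT isT) ? /(_ isT isT) ? /(_ isT isT) ? /(_ isT isT) ?.
  lra.
exists (a + i * (w / 2), c + j * (h / 2)) => /=; split => //; nra.
Qed.

(** The nested rectangles are recorded by their lower left corners; the sides
are halved at each step. *)
Let side (l : R) k : R := l / 2 ^+ k.

Let flux_nested : exists s : nat -> R * R, forall k,
  [/\ box (side (b0 - a0) k) (side (d0 - c0) k) (s k),
     [/\ (s k).1 <= (s k.+1).1,
      (s k.+1).1 + side (b0 - a0) k.+1 <= (s k).1 + side (b0 - a0) k,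
      (s k).2 <= (s k.+1).2 &
      (s k.+1).2 + side (d0 - c0) k.+1 <= (s k).2 + side (d0 - c0) k] &
     `|flux a0 b0 c0 d0| <= 4 ^+ k *
       `|flux (s k).1 ((s k).1 + side (b0 - a0) k)
              (s k).2 ((s k).2 + side (d0 - c0) k)|].
Proof.
pose W := side (b0 - a0); pose H := side (d0 - c0).
have W0 k : 0 <= W k by rewrite divr_ge0 ?subr_ge0// exprn_ge0.
have H0 k : 0 <= H k by rewrite divr_ge0 ?subr_ge0// exprn_ge0.
have WS k : W k.+1 = W k / 2 by rewrite /W /side exprSr invfM mulrA.
have HS k : H k.+1 = H k / 2 by rewrite /H /side exprSr invfM mulrA.
pose inv k p := box (W k) (H k) p /\ `|flux a0 b0 c0 d0| <= 4 ^+ k *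
  `|flux p.1 (p.1 + W k) p.2 (p.2 + H k)|.
pose nest k p q := [/\ p.1 <= q.1, q.1 + W k.+1 <= p.1 + W k, p.2 <= q.2 &
  q.2 + H k.+1 <= p.2 + H k].
have step k p : inv k p -> exists q, inv k.+1 q /\ nest k p q.
  move=> [[p1 p2 p3 p4] Fp].
  have [|q [q1 q2 q3 q4 Fq]] := flux_bisect (W0 k) (H0 k) _ (p := p); first by split.
  exists q; rewrite /nest /inv WS HS; split=> //; split; first by split; lra.
  by rewrite exprSr -mulrA (le_trans Fp)// ler_wpM2l// exprn_ge0.
have stepT (x : {kp : nat * (R * R) | inv kp.1 kp.2}) :
    {y : {kp : nat * (R * R) | inv kp.1 kp.2} |
      (sval y).1 = (sval x).1.+1 /\ nest (sval x).1 (sval x).2 (sval y).2}.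
  case: x => -[k p] /= ip; have [q [iq nq]] := cid (step k p ip).
  by exists (exist _ (k.+1, q) iq).
have i0 : inv 0%N (a0, c0).
  rewrite /inv /W /H /side /= expr0 !divr1 mul1r.
  rewrite !(addrC _ (_ - _)) !subrK; split=> //.
  by split => /=; rewrite ?(addrC _ (_ - _)) ?subrK.
have [f [f0 fS]] := dependent_choice stepT (exist _ (0%N, (a0, c0)) i0).
have fk k : (sval (f k)).1 = k.
  by elim: k => [|k IH]; [rewrite f0|rewrite (fS k).1 IH].
exists (fun k => (sval (f k)).2) => k.
have := svalP (f k); rewrite fk => -[b1 b2].
have := (fS k).2; rewrite fk => -[n1 n2 n3 n4].
by split.
Qed.

Hypothesis diffUV : forall x y, a0 <= x <= b0 -> c0 <= y <= d0 ->
  exists p q r : R, forall e : R, 0 < e -> exists2 delta : R, 0 < delta &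
    forall x' y', `|x' - x| <= delta -> `|y' - y| <= delta ->
    `|U x' y' - U x y - p * (x' - x) - q * (y' - y)|
      <= e * (`|x' - x| + `|y' - y|) /\
    `|V x' y' - V x y - r * (x' - x) - p * (y' - y)|
      <= e * (`|x' - x| + `|y' - y|).

Let nested_limit (u : nat -> R) (l : R) : 0 <= l ->
  (forall k, u k <= u k.+1 /\ u k.+1 + side l k.+1 <= u k + side l k) ->
  exists z, forall k, u k <= z <= u k + side l k.
Proof.
move=> l0 uS.
have mono m n : (m <= n)%N -> u m <= u n /\ u n + side l n <= u m + side l m.
  move=> /subnK <-; elim: (n - m)%N => [|d [IH1 IH2]]; first by rewrite add0n.
  by rewrite addSn; have [? ?] := uS (d + m)%N; split; lra.
have ub m n : u m <= u n + side l n.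
  have sd k : 0 <= side l k by rewrite divr_ge0// exprn_ge0.
  have [mn|/ltnW nm] := leqP m n.
    by have [? ?] := mono _ _ mn; have := sd n; lra.
  by have [? ?] := mono _ _ nm; have := sd m; lra.
exists (sup (range u)) => k; apply/andP; split.
  apply: ub_le_sup; last by exists k.
  by exists (u k + side l k) => _ [m _ <-].
apply: ge_sup; first by exists (u k), k.
by move=> _ [m _ <-].
Qed.

(** A nonzero flux would be inherited, up to a factor [4 ^+ k], by a nested
sequence of rectangles; but by [flux_near] at their common point, the flux of
the [k]-th one is [o(4 ^- k)]. *)
Lemma flux_eq0 : flux a0 b0 c0 d0 = 0.
Proof.
have [s sP] := flux_nested.
have WH0 : (0 : R) <= b0 - a0 /\ (0 : R) <= d0 - c0 by rewrite !subr_ge0.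
have [||x xP] := @nested_limit (fun k => (s k).1) (b0 - a0).
  exact: WH0.1.
  by move=> k; have [_ [? ? ? ?] _] := sP k.
have [||y yP] := @nested_limit (fun k => (s k).2) (d0 - c0).
  exact: WH0.2.
  by move=> k; have [_ [? ? ? ?] _] := sP k.
have sd0 (l : R) k : 0 <= l -> 0 <= side l k by move=> l0; rewrite divr_ge0// exprn_ge0.
have [/= x0 y0] : a0 <= x <= b0 /\ c0 <= y <= d0.
  have [[? ? ? ?] _ _] := sP 0%N; have := xP 0%N; have := yP 0%N; split; lra.
have [p [q [r D]]] := diffUV x0 y0.
have bound (e : R) : 0 < e ->
    `|flux a0 b0 c0 d0| <= e * (2 * ((b0 - a0) + (d0 - c0)) ^+ 2).
  move=> e0; have [de de0 De] := D _ e0.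
  pose L := (b0 - a0) + (d0 - c0).
  have [k kP] : exists k, L / 2 ^+ k <= de.
    have L0 : 0 <= L by rewrite /L; lra.
    pose k := Num.truncn (L / de); exists k.
    rewrite ler_pdivrMr ?exprn_gt0// mulrC -ler_pdivrMr//.
    apply: (le_trans (ltW (truncnS_gt _))).
    by rewrite -natrX ler_nat ltn_expl.
  have [[bx3 bx1 bx4 bx2] _ Fk] := sP k.
  move: (s k).1 (s k).2 bx3 bx4 bx1 bx2 Fk (xP k) (yP k) => a c bx3 bx4 bx1 bx2 Fk xa yc.
  have := sd0 _ k WH0.1; have := sd0 _ k WH0.2.
  have whd : side (b0 - a0) k + side (d0 - c0) k = L / 2 ^+ k by rewrite -mulrDl.
  move: (side (b0 - a0) k) (side (d0 - c0) k) whd bx1 bx2 Fk xa yc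
    => w h whd bx1 bx2 Fk xa yc h0 w0.
  have De' x' y' : a <= x' <= a + w -> c <= y' <= c + h ->
    `|U x' y' - U x y - p * (x' - x) - q * (y' - y)| <= e * (w + h) /\
    `|V x' y' - V x y - r * (x' - x) - p * (y' - y)| <= e * (w + h).
    move=> x'a y'c.
    have xw : `|x' - x| <= w by rewrite ler_norml; lra.
    have yh : `|y' - y| <= h by rewrite ler_norml; lra.
    have [||D1 D2] := De x' y'; [lra|lra|].
    have : e * (`|x' - x| + `|y' - y|) <= e * (w + h).
      exact: (ler_wpM2l (ltW e0) (lerD xw yh)).
    by split; lra.
  have Fs : `|flux a (a + w) c (c + h)| <= 2 * e * (w + h) ^+ 2.
    exact: (flux_near bx3 w0 bx1 bx4 h0 bx2 De').
  apply: (le_trans Fk); rewrite mulrC -ler_pdivlMr ?exprn_gt0//.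
  apply: (le_trans Fs); rewrite whd expr_div_n -exprM mulnC exprM.
  rewrite (_ : (4 : R) = 2 ^+ 2); last by rewrite -natrX.
  move: ((2 ^+ 2 ^+ k)^-1) => v; rewrite le_eqVlt; apply/orP; left; apply/eqP.
  by rewrite -/L; ring.
apply/eqP; rewrite -normr_le0 leNgt; apply/negP => F0.
pose K := 2 * ((b0 - a0) + (d0 - c0)) ^+ 2.
have K0 : 0 <= K by rewrite mulr_ge0// sqr_ge0.
have K1 : 0 < K + 1 by apply: ltr_wpDl.
pose G : R := `|flux a0 b0 c0 d0| / (K + 1).
have FG : `|flux a0 b0 c0 d0| = G * (K + 1) by rewrite divfK// gt_eqF.
have G0 : 0 < G by rewrite divr_gt0.
have := bound (G / 2); rewrite -/K FG divr_gt0// => /(_ isT).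
have : 0 <= G * K by rewrite mulr_ge0// ltW.
lra.
Qed.

End Flux.

(** * The complex exponential *)

Section FirstOrder.
Variable K : numFieldType.
Implicit Types (f : K -> K) (x d : K).

Let quotient_error f x d (h : K) : h != 0 ->
  `|d - h^-1 *: (f (h *: 1 + x) - f x)| * `|h| = `|f (x + h) - f x - d * h|.
Proof.
move=> h0; rewrite -normrM -normrN -mulNr opprB /GRing.scale/= mulr1 mulrBl.
by rewrite mulrAC mulVf// mul1r (addrC h).
Qed.

Lemma is_derive_expansion f x d : is_derive x 1 f d ->
  forall e : K, 0 < e -> exists2 delta : K, 0 < delta &
    forall h, `|h| < delta -> `|f (x + h) - f x - d * h| <= e * `|h|.
Proof.
move=> [df fd] e e0; move/cvgP : df => /= df.
have /cvgrPdist_le /(_ e e0) : h^-1 *: (f (h *: 1 + x) - f x) @[h --> 0^'] --> d.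
  by rewrite -fd.
case=> delta /= delta0 D; exists delta => // h hd.
have [->|h0] := eqVneq h 0; first by rewrite addr0 subrr mulr0 subr0 normr0 mulr0.
have := D h; rewrite /= sub0r normrN => /(_ hd h0).
by rewrite -quotient_error// ler_pM2r ?normr_gt0.
Qed.

Lemma expansion_is_derive f x d :
  (forall e : K, 0 < e -> exists2 delta : K, 0 < delta &
    forall h, `|h| < delta -> `|f (x + h) - f x - d * h| <= e * `|h|) ->
  is_derive x 1 f d.
Proof.
move=> H.
have C : h^-1 *: (f (h *: 1 + x) - f x) @[h --> 0^'] --> d.
  apply/cvgrPdist_le => e e0; have [delta delta0 D] := H e e0.
  exists delta => //= h; rewrite /= sub0r normrN => hd h0.
  by have := D h hd; rewrite -quotient_error// ler_pM2r ?normr_gt0.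
by split; [apply/cvg_ex; exists d|exact/cvg_lim].
Qed.

End FirstOrder.

Section ComplexExp.
Variable R : realType.
Implicit Types w z : Cplx R.

Definition cexp w : Cplx R :=
  Complex (expR (complex.Re w) * cos (complex.Im w))
          (expR (complex.Re w) * sin (complex.Im w)).

Lemma cexpD w z : cexp (w + z) = cexp w * cexp z.
Proof.
case: w z => [a b] [c d]; apply/eqP; rewrite eq_complex /= expRD cosD sinD.
by apply/andP; split; apply/eqP; ring.
Qed.

Lemma modulus_cexp w : modulus (cexp w) = expR (complex.Re w).
Proof.
rewrite modulusRI !exprMn -mulrDr cos2Dsin2 mulr1 sqrtr_sqr.
by rewrite ger0_norm// expR_ge0.
Qed.

Lemma cexp_neq0 w : cexp w != 0.
Proof. by rewrite -modulus_gt0 modulus_cexp expR_gt0. Qed.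

Lemma cexp_periodic (x y : R) : cexp (x +i* (y + pi *+ 2))%C = cexp (x +i* y)%C.
Proof. by rewrite /cexp/= cosD2pi sinD2pi. Qed.

Let cexp_expansion0 (e : R) : 0 < e -> exists2 delta : R, 0 < delta &
  forall h : Cplx R, modulus h < delta ->
    modulus (cexp h - 1 - h) <= e * modulus h.
Proof.
move=> e0.
(* the real and imaginary parts will cost [4 * eps] and [5 * eps] *)
have [eps [eps0 eps1 epse]] : exists eps : R, [/\ 0 < eps, eps <= 1 & eps <= e / 20].
  exists (Num.min 1 (e / 20)).
  by rewrite lt_min ltr01 divr_gt0// !ge_min !lexx orbT.
have [d1 d10 E1] := is_derive_expansion (is_derive_expR (0 : R)) eps0.
have [d2 d20 E2] := is_derive_expansion (is_derive_cos (0 : R)) eps0.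
have [d3 d30 E3] := is_derive_expansion (is_derive_sin (0 : R)) eps0.
exists (Num.min eps (Num.min d1 (Num.min d2 d3))); first by rewrite !lt_min eps0 d10 d20 d30.
move=> h; rewrite !lt_min => /and4P[heps h1 h2 h3].
have [ur vr] := (Re_le_modulus h, Im_le_modulus h).
apply: (le_trans (modulus_le _)).
move: ur vr heps h1 h2 h3; move: (modulus h) => m.
case: h => u v /= um vm meps m1 m2 m3.
have := E1 u (le_lt_trans um m1); have := E2 v (le_lt_trans vm m2).
have := E3 v (le_lt_trans vm m3).
rewrite !add0r expR0 cos0 sin0 oppr0 mul0r !subr0 !mul1r => e3 e2 e1.
rewrite ?subr0 !addr0 in e3 *.
have X0 := expR_gt0 u.
move: (expR u) (cos v) (sin v) e1 e2 e3 X0 => X C S e1 e2 e3 X0.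
have u1 : `|u| <= 1 by lra.
have X3 : X <= 3.
  have : eps * `|u| <= 1 * 1 by rewrite ler_pM// ltW.
  move: (ler_norm (X - 1 - u)) (ler_norm u); lra.
have B1 : `|X * C - 1 - u| <= 4 * eps * m.
  rewrite (_ : X * C - 1 - u = (X - 1 - u) + X * (C - 1)); last by ring.
  rewrite (le_trans (ler_normD _ _))// normrM (gtr0_norm X0).
  have : X * `|C - 1| <= 3 * (eps * m).
    by apply: ler_pM => //; [exact: ltW|rewrite (le_trans e2)// ler_wpM2l// ltW].
  have : eps * `|u| <= eps * m by rewrite ler_wpM2l// ltW.
  lra.
have B2 : `|X * S - v| <= 5 * eps * m.
  rewrite (_ : X * S - v = X * (S - v) + (X - 1) * v); last by ring.
  rewrite (le_trans (ler_normD _ _))// !normrM (gtr0_norm X0).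
  have : X * `|S - v| <= 3 * (eps * m).
    by apply: ler_pM => //; [exact: ltW|rewrite (le_trans e3)// ler_wpM2l// ltW].
  have : `|X - 1| * `|v| <= (2 * eps) * m.
    apply: ler_pM => //; rewrite (_ : X - 1 = (X - 1 - u) + u); last by ring.
    rewrite (le_trans (ler_normD _ _))//.
    have : eps * `|u| <= 1 * `|u| by rewrite ler_wpM2r.
    lra.
  lra.
have m0 : 0 <= m by rewrite (le_trans _ um).
have : eps * m <= e / 20 * m by rewrite ler_wpM2r.
have : 0 <= e * m by rewrite mulr_ge0// ltW.
lra.
Qed.

Lemma is_derive_cexp w : is_derive w 1 cexp (cexp w).
Proof.
apply: expansion_is_derive => e e0.
have [er er0 ->] := gt0_real_complex e0.
have M0 : 0 < modulus (cexp w) by rewrite modulus_gt0 cexp_neq0.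
have [d d0 D] := cexp_expansion0 (divr_gt0 er0 M0).
exists d%:C%C; first by rewrite ltcR.
move=> h; rewrite -modulusE ltcR => /D hd.
rewrite cexpD (_ : _ - _ = cexp w * (cexp h - 1 - h)); last by ring.
rewrite -!modulusE -rmorphM lecR modulusM -ler_pdivlMl//.
by rewrite (le_trans hd)// mulrCA mulrA.
Qed.

End ComplexExp.

(** * The mean value property and the Schwarz lemma *)

Section MeanValue.
Variable R : realType.
Implicit Types (G H : Cplx R -> Cplx R).

Let slope_continuous (f : R -> R) (x l d : R) : 0 < d ->
  (forall x', `|x' - x| <= d -> `|f x' - f x| <= l * `|x' - x|) ->
  {for x, continuous f}.
Proof.
move=> d0 fl; apply/cvgrPdist_le => e e0.
have l1 : 0 < `|l| + 1 by rewrite ltr_wpDl.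
exists (Num.min d (e / (`|l| + 1))); first by rewrite /= lt_min d0 divr_gt0.
move=> x' /=; rewrite lt_min => /andP[]; rewrite distrC => xd xe.
rewrite distrC (le_trans (fl _ (ltW xd)))//.
have : l * `|x' - x| <= (`|l| + 1) * `|x' - x|.
  by rewrite ler_wpM2r//; move: (ler_norm l); lra.
move: xe; rewrite ltr_pdivlMr// mulrC; lra.
Qed.

(** The derivative [p + i q] acts on [(x, y)] by the Cauchy-Riemann matrix. *)
Let real_expansion H (x y : R) : derivable H (x +i* y)%C 1 ->
  exists p q : R, forall e : R, 0 < e -> exists2 delta : R, 0 < delta &
    forall x' y', `|x' - x| <= delta -> `|y' - y| <= delta ->
    `|complex.Re (H (x' +i* y')%C) - complex.Re (H (x +i* y)%C)
        - p * (x' - x) - (- q) * (y' - y)| <= e * (`|x' - x| + `|y' - y|) /\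
    `|complex.Im (H (x' +i* y')%C) - complex.Im (H (x +i* y)%C)
        - q * (x' - x) - p * (y' - y)| <= e * (`|x' - x| + `|y' - y|).
Proof.
move=> /derivableP dH0; have [d dH] : exists d : Cplx R, is_derive ((x +i* y)%C : Cplx R) 1 H d.
  by exists ('D_1 H ((x +i* y)%C : Cplx R)).
exists (complex.Re d), (complex.Im d) => e e0.
have [|D D0 DH] := is_derive_expansion dH (e := e%:C%C); first by rewrite ltcR.
have [dr dr0 dE] := gt0_real_complex D0; exists (dr / 3); first by rewrite divr_gt0.
move=> x' y' xx yy.
pose h : Cplx R := Complex (x' - x) (y' - y).
have hE : modulus h <= `|x' - x| + `|y' - y| by exact: modulus_le.
have hd : `|h| < D by rewrite dE -modulusE ltcR; lra.
have := DH h hd.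
rewrite -!modulusE -rmorphM lecR => /le_trans/(_ (ler_wpM2l (ltW e0) hE)) {}DH.
have -> : (x' +i* y')%C = (x +i* y)%C + h.
  by rewrite /h /=; congr Complex; rewrite addrC subrK.
split.
  apply: le_trans DH; apply: le_trans (Re_le_modulus _).
  by rewrite !ReBc ReMc /=; rewrite le_eqVlt; apply/orP; left; apply/eqP; congr `|_|; ring.
apply: le_trans DH; apply: le_trans (Im_le_modulus _).
by rewrite !ImBc ImMc /=; rewrite le_eqVlt; apply/orP; left; apply/eqP; congr `|_|; ring.
Qed.

(** Pulling back by [cexp] turns circles into vertical segments; the horizontal
sides of the rectangle cancel by periodicity. *)
Lemma mean_value_strip H (s0 s1 : R) : s0 <= s1 -> s1 < 0 ->
  (forall w, complex.Re w < 0 -> derivable H w 1) ->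
  (forall x : R, H (x +i* (pi *+ 2))%C = H (x +i* 0)%C) ->
  (forall s y : R, s < 0 -> {for y, continuous (fun y => complex.Re (H (s +i* y)%C))}) /\
  segint 0 (pi *+ 2) (fun y => complex.Re (H (s1 +i* y)%C)) =
  segint 0 (pi *+ 2) (fun y => complex.Re (H (s0 +i* y)%C)).
Proof.
move=> s01 s10 dH perH.
pose U x y := complex.Re (H (x +i* y)%C); pose V x y := complex.Im (H (x +i* y)%C).
have cU (s y : R) : s < 0 -> {for y, continuous (U s)}.
  move=> ss; have [p [q /(_ _ ltr01) [d d0 D]]] := real_expansion (dH (s +i* y)%C ss).
  apply: (@slope_continuous _ _ (1 + `|q|) _ d0) => y' yy.
  have [] := D s y' _ yy; first by rewrite subrr normr0 ltW.
  rewrite subrr normr0 mulr0 subr0 add0r mul1r -/(U s y') -/(U s y) mulNr opprK => h _.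
  rewrite (_ : U s y' - U s y = U s y' - U s y + q * (y' - y) - q * (y' - y)); last by ring.
  by rewrite (le_trans (ler_normB _ _))// normrM mulrDl mul1r lerD.
have cV (y s : R) : s < 0 -> {for s, continuous (V^~ y)}.
  move=> ss; have [p [q /(_ _ ltr01) [d d0 D]]] := real_expansion (dH (s +i* y)%C ss).
  apply: (@slope_continuous _ _ (1 + `|q|) _ d0) => s' yy.
  have [|_] := D s' y yy; first by rewrite subrr normr0 ltW.
  rewrite subrr normr0 mulr0 subr0 addr0 mul1r -/(V s' y) -/(V s y) => h.
  rewrite (_ : V s' y - V s y = V s' y - V s y - q * (s' - s) + q * (s' - s)); last by ring.
  by rewrite (le_trans (ler_normD _ _))// normrM mulrDl mul1r lerD.
split=> //.
have pi20 : 0 <= pi *+ 2 :> R by rewrite mulrn_wge0// pi_ge0.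
have := @flux_eq0 R U V s0 s1 0 (pi *+ 2) s01 pi20.
rewrite /flux (_ : V^~ (pi *+ 2) = V^~ 0); last by apply/funext => x; rewrite /V perH.
rewrite subrr subr0 => /(_ _ _ _)/subr0_eq; apply.
- move=> x /andP[_ x1]; apply: continuous_in_subspaceT => y _.
  by apply: cU; lra.
- move=> y _; apply: continuous_in_subspaceT => x.
  by rewrite inE/= in_itv/= => /andP[_ x1]; apply: cV; lra.
move=> x y /andP[_ x1] _.
have [|p [q D]] := @real_expansion H x y; first by apply: dH => /=; lra.
by exists p, (- q), q.
Qed.

(** The mean over a small circle is close to [Re L], the mean over the circle of
radius [r] is at most [B], and both are equal. *)
Lemma disc_center_le G (L : Cplx R) (r B : R) : 0 < r < 1 ->
  (forall z, 0 < modulus z < 1 -> derivable G z 1) ->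
  (forall e : R, 0 < e -> exists2 d : R, 0 < d &
     forall z, 0 < modulus z < d -> modulus (G z - L) <= e) ->
  (forall z, modulus z = r -> modulus (G z) <= B) ->
  `|complex.Re L| <= B.
Proof.
move=> /andP[r0 r1] dG GL GB; rewrite leNgt; apply/negP => BL.
have [|d d0 Gd] := GL ((`|complex.Re L| - B) / 2); first by lra.
pose H w := G (cexp w).
(* circles of radius [r] and of radius at most [d / 2] *)
pose s1 := ln r; pose s0 := Num.min s1 (ln (d / 2)).
have s1N : s1 < 0 by rewrite /s1 ln_lt0// r0.
have s01 : s0 <= s1 by rewrite /s0 ge_min lexx.
have [||cU] := @mean_value_strip H s0 s1 s01 s1N.
- move=> w w0; apply/derivable1_diffP; apply: differentiable_comp.
    by apply/derivable1_diffP; have [] := is_derive_cexp w.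
  apply/derivable1_diffP; apply: dG.
  by rewrite modulus_cexp expR_gt0 -expR0 ltr_expR.
- by move=> x; rewrite /H -[pi *+ 2]add0r cexp_periodic.
move: (@pi_gt0 R) => pi0.
have pi2 : 0 <= pi *+ 2 :> R by rewrite mulrn_wge0// ltW.
have cs s : s < 0 -> {within `[0, pi *+ 2], continuous (fun y => complex.Re (H (s +i* y)%C))}.
  by move=> sN; apply: continuous_in_subspaceT => y _; exact: cU.
have c0 : {within `[0, pi *+ 2], continuous (cst 0 : R -> R)}.
  by move=> y; exact: cst_continuous.
have := @segint_near R 0 (pi *+ 2) _ _ 0 B pi2 (cs _ s1N) c0.
have := @segint_near R 0 (pi *+ 2) _ _ (complex.Re L) ((`|complex.Re L| - B) / 2) pi2
  (cs _ (le_lt_trans s01 s1N)) c0.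
move=> E1 E2 E3; move: E1 E2; rewrite {}E3.
move: (segint _ _ _) (segint _ _ _) => J I E1 E2.
have {}E1 : `|I - J - complex.Re L * (pi *+ 2 - 0)| <= (`|complex.Re L| - B) / 2 * (pi *+ 2 - 0).
  apply: E1 => y _; rewrite subr0 -ReBc (le_trans (Re_le_modulus _))//.
  apply: Gd; rewrite modulus_cexp expR_gt0/=.
  rewrite (@le_lt_trans _ _ (d / 2))//; last by lra.
  rewrite -[leRHS]lnK ?posrE ?divr_gt0// ler_expR.
  by rewrite ge_min lexx orbT.
have {}E2 : `|I - J - 0 * (pi *+ 2 - 0)| <= B * (pi *+ 2 - 0).
  apply: E2 => y _; rewrite !subr0 (le_trans (Re_le_modulus _))//.
  by apply: GB; rewrite modulus_cexp/= lnK.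
move: E1 E2; rewrite mul0r !subr0 => E1 E2.
have : `|complex.Re L| * (pi *+ 2) <= (B + (`|complex.Re L| - B) / 2) * (pi *+ 2).
  rewrite -{1}(ger0_norm pi2) -normrM mulrDl.
  rewrite (_ : complex.Re L * _ = (I - J) - (I - J - complex.Re L * (pi *+ 2))); last by ring.
  by rewrite (le_trans (ler_normB _ _))// lerD.
rewrite ler_pM2r; last by rewrite pmulrn_lgt0.
lra.
Qed.

(** The Schwarz lemma for [z ^+ k * G z], a function bounded by [M] with a zero of
order at least [k]: on the circle of radius [r], [G] is bounded by [M / r ^+ k], which
tends to [M] as [r] tends to [1]. *)
Lemma schwarz_center G (L : Cplx R) (M : R) k :
  (forall z, 0 < modulus z < 1 -> derivable G z 1) ->
  (forall e : R, 0 < e -> exists2 d : R, 0 < d &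
     forall z, 0 < modulus z < d -> modulus (G z - L) <= e) ->
  (forall z, 0 < modulus z < 1 -> modulus z ^+ k * modulus (G z) <= M) ->
  `|complex.Re L| <= M.
Proof.
move=> dG GL GM.
have H (r : R) : 0 < r < 1 -> r ^+ k * `|complex.Re L| <= M.
  move=> r01; have /andP[r0 r1] := r01.
  rewrite mulrC -ler_pdivlMr ?exprn_gt0//.
  apply: (disc_center_le r01 dG GL) => z zr.
  by rewrite ler_pdivlMr ?exprn_gt0// mulrC -zr GM// zr.
rewrite leNgt; apply/negP => ML.
have L0 : 0 < `|complex.Re L|.
  have /H H2 : 0 < (1 / 2 : R) < 1 by lra.
  have : 0 <= (1 / 2) ^+ k * `|complex.Re L| by rewrite mulr_ge0// exprn_ge0.
  by move: H2; lra.
(* the bound at radius [expR (- s)], together with [1 - k * s <= expR (- s) ^+ k] *)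
pose s : R := (`|complex.Re L| - M) / (2 * k.+1%:R * `|complex.Re L|).
have s0 : 0 < s by rewrite divr_gt0 ?subr_gt0// !mulr_gt0.
have := H (expR (- s)).
rewrite expR_gt0 -expR0 ltr_expR oppr_lt0 s0 => /(_ isT).
rewrite -expRM_natl leNgt => /negP; apply.
have : (1 + k%:R * - s) * `|complex.Re L| <= expR (k%:R * - s) * `|complex.Re L|.
  by rewrite ler_wpM2r// expR_ge1Dx.
have : s * `|complex.Re L| * k.+1%:R = (`|complex.Re L| - M) / 2.
  by rewrite /s; field; rewrite gt_eqF//= pnatr_eq0.
rewrite -natr1; have : 0 < s * `|complex.Re L| by rewrite mulr_gt0.
lra.
Qed.

End MeanValue.

(** * The Kobayashi-Royden metric of the domain at the origin *)

Section DnSchwarz.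
Variables (R : realType) (n : nat).
Implicit Types (X z : 'rV[Cplx R]_n.+1) (j : 'I_n.+1).

Definition energy z : R := \sum_(j < n.+1 | j != ord0)
  (2 * modulus (z ord0 ord0 ^+ 3 - z ord0 j ^+ 3)
   + modulus (z ord0 ord0 ^+ 3 + z ord0 j ^+ 3)).

Lemma DnE z : @Dn R n z <-> energy z < 2 * n%:R.
Proof.
rewrite /Dn /= (_ : \sum_(j < n.+1 | j != ord0) _ = (energy z)%:C%C).
  by rewrite (_ : 2 * n%:R = (2 * n%:R)%:C%C) ?ltcR// rmorphM !rmorph_nat.
rewrite /energy rmorph_sum/=; apply: eq_bigr => j _.
by rewrite rmorphD rmorphM/= !modulusE rmorph_nat.
Qed.

Lemma energyZ (a : Cplx R) z : energy (a *: z) = modulus a ^+ 3 * energy z.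
Proof.
rewrite /energy mulr_sumr; apply: eq_bigr => j _.
by rewrite !mxE !exprMn -mulrBr -mulrDr !(modulusM (a ^+ 3)) modulusX; ring.
Qed.

Lemma energy_ge0 z : 0 <= energy z.
Proof. by apply: sumr_ge0 => j _; rewrite addr_ge0 ?mulr_ge0 ?modulus_ge0. Qed.

(** A unimodular number rotating [a] onto its modulus ([0] when [a = 0]). *)
Let phase (a : Cplx R) : Cplx R := `|a| / a.

Let phaseM a : phase a * a = (modulus a)%:C%C.
Proof.
rewrite /phase modulusE; have [->|a0] := eqVneq a 0; last by rewrite divfK.
by rewrite normr0 mulr0.
Qed.

Let modulus_phase a : modulus (phase a) <= 1.
Proof.
rewrite /phase modulusM modulusV -modulusE modulus_real ger0_norm ?modulus_ge0//.
have [->|a0] := eqVneq (modulus a) 0; first by rewrite mul0r.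
by rewrite divff.
Qed.

Let phase_le a w : modulus (phase a * w) <= modulus w.
Proof. by rewrite modulusM ler_piMl ?modulus_ge0 ?modulus_phase. Qed.

Let cubic (c d : Cplx R) j z : Cplx R :=
  c * (z ord0 ord0 ^+ 3 - z ord0 j ^+ 3) + d * (z ord0 ord0 ^+ 3 + z ord0 j ^+ 3).

(** A holomorphic cubic form dominated by [energy] and equal to it at [X]: it
reduces the Schwarz lemma for [energy] to the one for scalar functions. *)
Let support X z : Cplx R := \sum_(j < n.+1 | j != ord0)
  cubic (2 * phase (X ord0 ord0 ^+ 3 - X ord0 j ^+ 3))
        (phase (X ord0 ord0 ^+ 3 + X ord0 j ^+ 3)) j z.

Let support_id X : support X X = (energy X)%:C%C.
Proof.
rewrite /support /energy rmorph_sum/=; apply: eq_bigr => j _.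
by rewrite /cubic -mulrA !phaseM rmorphD rmorphM rmorph_nat.
Qed.

Let support_le X z : modulus (support X z) <= energy z.
Proof.
rewrite (le_trans (le_modulus_sum _ _ _))//; apply: ler_sum => j _.
rewrite (le_trans (le_modulusD _ _))// lerD ?phase_le// -mulrA (modulusM 2).
by rewrite modulus_nat ler_wpM2l ?phase_le.
Qed.

Let supportZ X (a : Cplx R) z : support X (a *: z) = a ^+ 3 * support X z.
Proof.
rewrite /support mulr_sumr; apply: eq_bigr => j _.
by rewrite /cubic !mxE !exprMn; ring.
Qed.

Let cubic_differentiable c d j z : differentiable (cubic c d j) z.
Proof.
pose e i : 'rV[Cplx R]_n.+1 -> Cplx R := fun z => z ord0 i.
have de i : differentiable (e i ^+ 3) z.
  by apply: differentiableX; exact: differentiable_coord.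
rewrite (_ : cubic c d j =
    c *: (e ord0 ^+ 3 - e j ^+ 3) + d *: (e ord0 ^+ 3 + e j ^+ 3)); last first.
  by apply/funext => y; rewrite /cubic /e !fctE.
apply: differentiableD.
  by apply: (@differentiableZ _ _ _ (e ord0 ^+ 3 - e j ^+ 3)); exact: differentiableB.
by apply: (@differentiableZ _ _ _ (e ord0 ^+ 3 + e j ^+ 3)); exact: differentiableD.
Qed.

Let support_differentiable X z : differentiable (support X) z.
Proof.
rewrite (_ : support X = \sum_(j < n.+1) if j != ord0 then
  cubic (2 * phase (X ord0 ord0 ^+ 3 - X ord0 j ^+ 3))
        (phase (X ord0 ord0 ^+ 3 + X ord0 j ^+ 3)) j else cst 0).
  by apply: differentiable_sum => j; case: ifP => _.
apply/funext => y; rewrite fct_sumE /support big_mkcond.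
by apply: eq_bigr => j _; case: ifP.
Qed.

Let support_derivable X (phi : Cplx R -> 'rV[Cplx R]_n.+1) (z : Cplx R) :
  derivable phi z 1 -> derivable (support X \o phi) z 1.
Proof.
move=> /derivable1_diffP dphi; apply/derivable1_diffP; exact: differentiable_comp.
Qed.

(** The quotient [phi z / z] extends to [0] by [phi'(0)], and by homogeneity the
support form at [phi'(0)] takes on it values at most [2 * n / |z| ^ 3]. *)
Lemma energy_derive1_le (phi : Cplx R -> 'rV[Cplx R]_n.+1) :
  holomorphic_disc (@Dn R n) phi -> phi 0 = 0 ->
  energy (derive1 phi 0) <= 2 * n%:R.
Proof.
move=> hphi phi0; pose X := derive1 phi 0.
have disc0 : unit_disc (0 : Cplx R) by rewrite /unit_disc/= normr0.
have discP (z : Cplx R) : unit_disc z <-> modulus z < 1.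
  by rewrite /unit_disc/= -modulusE -ltcR.
rewrite -(ger0_norm (energy_ge0 _)) -[energy _]/(complex.Re (energy X)%:C%C) -support_id.
apply: (@schwarz_center R (fun z : Cplx R => support X (z^-1 *: phi z)) (support X X) (2 * n%:R) 3).
- move=> z /andP[z0 z1].
  rewrite (_ : (fun _ => _) = (fun t : Cplx R => t^-1) ^+ 3 * (support X \o phi)).
    apply: derivableM.
      apply: derivableX.
      apply: (@derivableV _ _ id); last exact: derivable_id.
      by rewrite -modulus_gt0.
    apply: support_derivable; by have [|] := hphi z; first exact/discP.
  by apply/funext => y; rewrite supportZ !fctE.
- move=> e e0.
  have : support X (h^-1 *: phi h) @[h --> 0^'] --> support X X.
    apply: (cvg_comp (fun h : Cplx R => h^-1 *: phi h) (support X)); last first.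
      exact: differentiable_continuous.
    have D := (hphi _ disc0).1.
    have -> : (fun h : Cplx R => h^-1 *: phi h) =
        (fun h => h^-1 *: (phi (h *: 1 + 0) - phi 0)).
      by apply/funext => h; rewrite phi0 subr0 addr0 [h *: 1]mulr1.
    by rewrite /X derive1E; exact: D.
  move/cvgrPdist_le => /(_ e%:C%C); rewrite ltcR => /(_ e0)[d /= d0 D].
  have [dr dr0 dE] := gt0_real_complex d0; exists dr => // z /andP[z0 zd].
  rewrite modulusC -lecR modulusE; apply: D.
    by rewrite /= sub0r normrN dE -modulusE ltcR.
  by rewrite -modulus_gt0.
move=> z /andP[z0 z1]; rewrite supportZ modulusM modulusX modulusV mulrA.
rewrite exprVn divff ?mul1r ?expf_neq0 ?gt_eqF//.
apply: (le_trans (support_le _ _)); apply/ltW/DnE.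
by have [|] := hphi z; first exact/discP.
Qed.

End DnSchwarz.

Section DnMetric.
Variables (R : realType) (n : nat).
Hypothesis n0 : (0 < n)%N.
Implicit Types X : 'rV[Cplx R]_n.+1.

Let n2 : 0 < 2 * n%:R :> R. Proof. by rewrite mulr_gt0// ltr0n. Qed.

Let linear_disc X : energy X <= 2 * n%:R -> exists phi : Cplx R -> 'rV[Cplx R]_n.+1,
  [/\ holomorphic_disc (@Dn R n) phi, phi 0 = 0 & derive1 phi 0 = X].
Proof.
move=> EX; pose phi (z : Cplx R) := z *: X; exists phi.
have dphi (z : Cplx R) : is_diff z phi ( *:%R ^~ X) by exact: is_diff_scalel.
split; last 2 first.
- by rewrite /phi scale0r.
- by rewrite derive1E' ?diff_val ?scale1r//; exact: ex_diff.
move=> z; rewrite /unit_disc/= -modulusE => z1; split.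
  by apply/derivable1_diffP; exact: ex_diff.
have {}z1 : modulus z < 1 by rewrite -ltcR.
apply/DnE; rewrite /phi energyZ (le_lt_trans (y := modulus z ^+ 3 * (2 * n%:R)))//.
  by rewrite ler_wpM2l// exprn_ge0// modulus_ge0.
by rewrite gtr_pMl// exprn_ilt1// modulus_ge0.
Qed.

Let cand X (alpha : R) := 0 <= alpha /\ exists phi : Cplx R -> 'rV[Cplx R]_n.+1,
  [/\ holomorphic_disc (@Dn R n) phi, phi 0 = 0
    & (alpha%:C%C : Cplx R) *: derive1 phi 0 = X].

Let cand_energy X alpha : cand X alpha -> energy X <= 2 * n%:R * alpha ^+ 3.
Proof.
move=> [a0 [phi [hphi phi0 <-]]]; rewrite energyZ modulus_real ger0_norm// mulrC.
by rewrite ler_wpM2r ?exprn_ge0// energy_derive1_le.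
Qed.

Let energy_cand X (alpha : R) : 0 < alpha -> energy X <= 2 * n%:R * alpha ^+ 3 -> cand X alpha.
Proof.
move=> a0 EX; split; first exact: ltW.
have [|phi [h1 h2 h3]] := @linear_disc ((alpha%:C%C : Cplx R)^-1 *: X).
  rewrite energyZ modulusV modulus_real gtr0_norm// exprVn mulrC.
  by rewrite ler_pdivrMr ?exprn_gt0.
exists phi; split=> //; rewrite h3 scalerA divff ?scale1r//.
by rewrite -modulus_gt0 modulus_real gtr0_norm.
Qed.

Lemma kobayashi_royden_Dn_le1 X : energy X <= 2 * n%:R ->
  kobayashi_royden (@Dn R n) 0 X <= 1.
Proof.
move=> EX; apply: ge_inf; first by exists 0 => y [].
by apply: energy_cand => //; rewrite expr1n mulr1.
Qed.

(** The lower estimate of the metric by the cube root of the energy, stated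
through a nearly optimal disc.  Linear discs show that there is a disc at all, so
that the infimum is not a default value. *)
Lemma kobayashi_royden_Dn_approx X (e : R) : 0 < e -> exists alpha : R,
  [/\ 0 <= alpha, alpha < kobayashi_royden (@Dn R n) 0 X + e &
      energy X <= 2 * n%:R * alpha ^+ 3].
Proof.
move=> e0.
have [|alpha ca ae] := @inf_adherent R [set alpha | cand X alpha] e e0.
  split; last by exists 0 => y [].
  have E1 : 1 <= energy X + 1 by rewrite lerDr energy_ge0.
  exists (energy X + 1); apply: energy_cand; first by rewrite (lt_le_trans ltr01).
  apply: (@le_trans _ _ ((energy X + 1) ^+ 3)).
    rewrite (@le_trans _ _ (energy X + 1))//; first by rewrite lerDl.
    by rewrite exprS ler_peMr// ?exprn_ege1// (le_trans ler01).
  rewrite ler_peMl ?exprn_ge0 ?(le_trans ler01)//.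
  by rewrite -natrM ler1n muln_gt0 n0.
by exists alpha; split=> //; [case: ca|exact: cand_energy].
Qed.

End DnMetric.

Section EnergyGeometry.
Variables (R : realType) (n : nat).
Implicit Types z : 'rV[Cplx R]_n.+1.

(** Summation of [2 |a - b| + |a + b| >= 2 |a| + |a - b|]; the last term records
the case of equality. *)
Lemma energy_ge_first z :
  2 * n%:R * modulus (z ord0 ord0) ^+ 3 +
  \sum_(j < n.+1 | j != ord0) modulus (z ord0 ord0 ^+ 3 - z ord0 j ^+ 3) <= energy z.
Proof.
have -> : 2 * n%:R * modulus (z ord0 ord0) ^+ 3 =
    \sum_(j < n.+1 | j != ord0) 2 * modulus (z ord0 ord0 ^+ 3).
  rewrite modulusX sumr_const (_ : #|_| = n); first by rewrite -mulr_natl; ring.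
  by rewrite cardC1 card_ord.
rewrite -big_split/=; apply: ler_sum => j _.
move: (_ ^+ 3) (_ ^+ 3) => b a.
have : modulus (a + a) <= modulus (a - b) + modulus (a + b).
  rewrite (_ : a + a = (a - b) + (a + b)); last by ring.
  exact: le_modulusD.
rewrite modulus_double; lra.
Qed.

Lemma energy_ge_other z j : j != ord0 -> 2 * modulus (z ord0 j) ^+ 3 <= energy z.
Proof.
move=> j0; rewrite /energy (bigD1 j)//=; set s := \sum_(_ | _) _.
have s0 : 0 <= s by apply: sumr_ge0 => i _; rewrite addr_ge0 ?mulr_ge0 ?modulus_ge0.
rewrite -modulusX; move: (_ ^+ 3) (_ ^+ 3) => a b.
have : modulus (b + b) <= modulus (b - a) + modulus (a + b).
  rewrite (_ : b + b = (b - a) + (a + b)); last by ring.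
  exact: le_modulusD.
rewrite modulus_double (modulusC b); move: (modulus_ge0 (a - b)); lra.
Qed.

Lemma modulus_first_le z (alpha : R) : (0 < n)%N -> 0 <= alpha ->
  energy z <= 2 * n%:R * alpha ^+ 3 -> modulus (z ord0 ord0) <= alpha.
Proof.
move=> n0 a0 Ez; have n3 : 0 < 2 * n%:R :> R by rewrite mulr_gt0// ltr0n.
rewrite -(@ler_pXn2r _ 3) ?nnegrE ?modulus_ge0//.
have := energy_ge_first z; set r := \sum_(_ | _) _ => E1.
have r0 : 0 <= r by apply: sumr_ge0 => i _; exact: modulus_ge0.
by rewrite -(ler_pM2l n3); lra.
Qed.

End EnergyGeometry.

(** * Attainment of the infimum over decompositions *)

Section Compactness.
Variable R : realType.

Lemma compact_min (T : topologicalType) (K : set T) (f : T -> R) :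
  compact K -> K !=set0 -> continuous f ->
  exists2 c, K c & forall t, K t -> f c <= f t.
Proof.
move=> cK K0 cf.
have [|c cK' cmin] := compact_EVT_min K0 cK (f := f).
  exact: continuous_subspaceT.
by exists c => [|t Kt]; [exact/set_mem|apply: cmin; exact/mem_set].
Qed.

Lemma sum_continuous (K : numFieldType) (V : normedModType K) (T : topologicalType)
    (I : Type) (r : seq I) (F : I -> T -> V) :
  (forall i, continuous (F i)) -> continuous (fun x => \sum_(i <- r) F i x).
Proof.
move=> cF; elim: r => [|i r IH] x.
  rewrite (_ : (fun _ => _) = cst 0); first exact: cst_continuous.
  by apply/funext => y; rewrite big_nil.
rewrite (_ : (fun _ => _) = (fun x => F i x + \sum_(j <- r) F j x)).
  by apply: cvgD; [exact: cF|exact: IH].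
by apply/funext => y; rewrite big_cons.
Qed.

Lemma continuous_add (K : numFieldType) (V : normedModType K) (T : topologicalType)
  (f g : T -> V) : continuous f -> continuous g -> continuous (fun x => f x + g x).
Proof. by move=> cf cg x; apply: cvgD; [exact: cf|exact: cg]. Qed.

Lemma continuous_sub (K : numFieldType) (V : normedModType K) (T : topologicalType)
  (f g : T -> V) : continuous f -> continuous g -> continuous (fun x => f x - g x).
Proof. by move=> cf cg x; apply: cvgB; [exact: cf|exact: cg]. Qed.

Lemma continuous_scale (T : topologicalType) (c : R) (f : T -> R) :
  continuous f -> continuous (fun x => c * f x).
Proof. by move=> cf x; apply: cvgMl_tmp; exact: cf. Qed.

Lemma continuous_scalel (K : numFieldType) (V : normedModType K) (T : topologicalType)
  (f : T -> K) (v : V) : continuous f -> continuous (fun x => f x *: v).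
Proof. by move=> cf x; apply: cvgZr_tmp; exact: cf. Qed.

Lemma mx_coord_continuous (T : topologicalType) m n (i : 'I_m) (j : 'I_n) :
  continuous (fun v : 'M[T]_(m, n) => v i j).
Proof.
move=> v A /= nA.
exists (fun i' j' => [set x | i' = i -> j' = j -> A x]).
  move=> i' j' /=; have [->|ii] := eqVneq i' i; last first.
    by apply: filterE => x /= /eqP; rewrite (negbTE ii).
  have [->|jj] := eqVneq j' j; last first.
    by apply: filterE => x /= _ /eqP; rewrite (negbTE jj).
  by apply: filterS nA => x Ax _ _.
by move=> w /= /(_ i j erefl erefl).
Qed.

Lemma compact_square (B : R) :
  compact [set z : Cplx R | `|complex.Re z| <= B /\ `|complex.Im z| <= B].
Proof.
pose f (p : R * R) : Cplx R := Complex p.1 p.2.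
rewrite (_ : mkset _ = f @` (`[- B, B] `*` `[- B, B])).
  apply: continuous_compact; last by apply: compact_setX; exact: segment_compact.
  apply: continuous_subspaceT => p; apply/cvgrPdist_le => e e0.
  have [er er0 ->] := gt0_real_complex e0.
  have e20 : 0 < er / 2 by rewrite divr_gt0.
  exists (ball p.1 (er / 2), ball p.2 (er / 2)) => /=.
    by split; exact: nbhsx_ballx.
  move=> [x y] /= [xp yp]; rewrite -modulusE lecR.
  apply: (le_trans (modulus_le _)); rewrite ReBc ImBc/=.
  by move: xp yp; rewrite /ball/=; lra.
apply/seteqP; split => [[x y]/= [Bx By]|_ [[x y] /= [Bx By] <-]].
  by exists (x, y) => //=; rewrite !in_itv/= -!ler_norml.
by move: Bx By; rewrite !in_itv/= -!ler_norml.
Qed.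

Lemma Re_continuous : continuous (@complex.Re R : Cplx R -> R).
Proof.
move=> z A /nbhs_ballP[e /= e0 eA]; apply/nbhs_ballP.
exists (e%:C%C); first by rewrite /= ltcR.
move=> w; rewrite /ball/= -modulusE ltcR => zw; apply: eA.
by rewrite /ball/= -ReBc (le_lt_trans (Re_le_modulus _)).
Qed.

Lemma modulus_continuous : continuous (@modulus R).
Proof.
move=> z A /nbhs_ballP[e /= e0 eA]; apply/nbhs_ballP.
exists (e%:C%C); first by rewrite /= ltcR.
move=> w; rewrite /ball/= -modulusE ltcR => zw; apply: eA.
rewrite /ball/= (le_lt_trans _ zw)//.
have := le_modulusD (z - w) w; have := le_modulusD (w - z) z.
by rewrite !subrK (modulusC w) ler_norml; lra.
Qed.

End Compactness.

Section Attained.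
Variables (R : realType) (n : nat).
Hypothesis n0 : (0 < n)%N.
Implicit Types X : 'rV[Cplx R]_n.+1.

Let energy_bound X (alpha : R) j : 0 <= alpha ->
  energy X <= 2 * n%:R * alpha ^+ 3 -> modulus (X ord0 j) <= n%:R * alpha.
Proof.
move=> a0 EX; have n1 : 1 <= n%:R :> R by rewrite ler1n.
have [->|j0] := eqVneq j ord0.
  by rewrite (le_trans (modulus_first_le n0 a0 EX))// ler_peMl.
rewrite -(@ler_pXn2r _ 3) ?nnegrE ?modulus_ge0 ?mulr_ge0//.
have := energy_ge_other X j0 => E1; rewrite exprMn.
have : n%:R * alpha ^+ 3 <= n%:R ^+ 3 * alpha ^+ 3.
  rewrite ler_wpM2r ?exprn_ge0// exprS ler_peMr// ?exprn_ege1//.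
lra.
Qed.

Let energy_continuous : continuous (@energy R n).
Proof.
have cX j : continuous (fun z : 'rV[Cplx R]_n.+1 => z ord0 j ^+ 3).
  move=> z; apply: differentiable_continuous.
  rewrite (_ : (fun _ => _) = (fun z : 'rV[Cplx R]_n.+1 => z ord0 j) ^+ 3).
    by apply: differentiableX; exact: differentiable_coord.
  by apply/funext => y; rewrite fctE.
have cM (f : 'rV[Cplx R]_n.+1 -> Cplx R) : continuous f -> continuous (@modulus R \o f).
  by move=> cf z; apply: continuous_comp; [exact: cf|exact: modulus_continuous].
pose F j (z : 'rV[Cplx R]_n.+1) : R := if j != ord0 then
  2 * modulus (z ord0 ord0 ^+ 3 - z ord0 j ^+ 3) + modulus (z ord0 ord0 ^+ 3 + z ord0 j ^+ 3)
  else 0.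
have -> : @energy R n = fun z => \sum_j F j z.
  by apply/funext => z; rewrite /energy big_mkcond.
apply: sum_continuous => j z; rewrite /F; case: (j != ord0); last exact: (@cst_continuous _ _ (0 : R)).
move: z; apply: continuous_add.
  apply: continuous_scale; apply: (cM (fun z => z ord0 ord0 ^+ 3 - z ord0 j ^+ 3)).
  by apply: continuous_sub; exact: cX.
apply: (cM (fun z => z ord0 ord0 ^+ 3 + z ord0 j ^+ 3)).
by apply: continuous_add; exact: cX.
Qed.

(** A decomposition is recorded with numbers [alpha i] that bound the metric of
its terms.  The energy controls all entries of a vector, so that the pairs of
cost at most [S + 1] form a compact set, on which the cost has a minimum. *)
Lemma kobayashi_Dn_attained m X (S : R) : (0 < m)%N ->
  kobayashi m (@Dn R n) 0 X <= S ->
  exists (Y : 'I_m -> 'rV[Cplx R]_n.+1) (alpha : 'I_m -> R),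
    [/\ \sum_i Y i = X, \sum_i alpha i <= S &
     forall i, 0 <= alpha i /\ energy (Y i) <= 2 * n%:R * alpha i ^+ 3].
Proof.
move=> m0 kS.
pose V := 'rV[Cplx R]_n.+1; pose T := ('rV[V]_m * 'rV[R]_m)%type.
pose feas : set T := [set v : T | \sum_i v.1 ord0 i = X /\
  forall i, 0 <= v.2 ord0 i /\ energy (v.1 ord0 i) <= 2 * n%:R * v.2 ord0 i ^+ 3].
pose cost (v : T) : R := \sum_i v.2 ord0 i.
have near (e : R) : 0 < e -> exists2 v, feas v & cost v <= S + e.
  move=> e0; have e2 : 0 < e / 2 by rewrite divr_gt0.
  have [|_ [Y YX <-] Ye] := @inf_adherent R
      [set \sum_(j < m) kobayashi_royden (@Dn R n) 0 (Y j) |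
       Y in [set Y : 'I_m -> V | \sum_(j < m) Y j = X]] (e / 2) e2.
    split; last first.
      by exists 0 => _ [Y _ <-]; apply: sumr_ge0 => i _; exact: kobayashi_royden_ge0.
    exists (\sum_(j < m) kobayashi_royden (@Dn R n) 0 (if j == Ordinal m0 then X else 0)).
    exists (fun j => if j == Ordinal m0 then X else 0) => //=.
    by rewrite -big_mkcond/= big_pred1_eq.
  have em : 0 < e / 2 / m%:R by rewrite !divr_gt0// ltr0n.
  have /choice[al alP] i := kobayashi_royden_Dn_approx n0 (Y i) em.
  exists (\row_i Y i, \row_i al i).
    split=> [|i /=]; first by rewrite -YX; apply: eq_bigr => i _; rewrite mxE.
    by rewrite !mxE; have [? ? ?] := alP i.
  have -> : cost (\row_i Y i, \row_i al i) = \sum_i al i.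
    by apply: eq_bigr => i _; rewrite mxE.
  apply: (@le_trans _ _ (\sum_(i < m) (kobayashi_royden (@Dn R n) 0 (Y i) + e / 2 / m%:R))).
    by apply: ler_sum => i _; have [_ /ltW] := alP i.
  rewrite big_split/= sumr_const card_ord -[_ *+ m]mulr_natr divfK ?pnatr_eq0 -?lt0n//.
  by move: Ye kS; rewrite /kobayashi; lra.
pose B : R := n%:R * (S + 1).
pose sq : set (Cplx R) := [set z | `|complex.Re z| <= B /\ `|complex.Im z| <= B].
pose boxV : set V := [set Y : V | forall j, sq (Y ord0 j)].
pose box : set T := [set v : 'rV[V]_m | forall i, boxV (v ord0 i)] `*`
  [set v : 'rV[R]_m | forall i, `[0, S + 1]%classic (v ord0 i)].
have cbox : compact box.
  apply: compact_setX.
    apply: (@rV_compact V m (fun=> boxV)) => _.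
    apply: (@rV_compact (Cplx R) _ (fun=> sq)) => _; exact: compact_square.
  by apply: (@rV_compact R m (fun=> `[0, S + 1]%classic)) => _; exact: segment_compact.
have cY i : continuous (fun v : T => v.1 ord0 i).
  move=> v; apply: (@continuous_comp _ _ _ (fun v : T => v.1) (fun w => w ord0 i)).
    exact: cvg_fst.
  exact: mx_coord_continuous.
have ca i : continuous (fun v : T => v.2 ord0 i).
  move=> v; apply: (@continuous_comp _ _ _ (fun v : T => v.2) (fun w => w ord0 i)).
    exact: cvg_snd.
  exact: coord_continuous.
have cK : compact (box `&` feas).
  apply: compact_closedI => //.
  rewrite (_ : feas = [set v : T | \sum_i v.1 ord0 i = X] `&`
     \bigcap_(i in setT) ([set v : T | 0 <= v.2 ord0 i] `&`
       [set v : T | energy (v.1 ord0 i) - 2 * n%:R * v.2 ord0 i ^+ 3 <= 0])); last first.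
    apply/seteqP; split=> [v [v1 v2]|v [v1 v2]].
      by split=> // i _; have [? ?] := v2 i; split=> //=; rewrite subr_le0.
    by split=> // i; have [/= ?] := v2 i I; rewrite subr_le0.
  apply: closedI.
    have /continuous_closedP H : continuous (fun v : T => \sum_i v.1 ord0 i).
      exact: sum_continuous.
    apply: (H [set X]); apply: accessible_closed_set1; apply: hausdorff_accessible.
    exact: norm_hausdorff.
  apply: closed_bigI => i _; apply: closedI.
    have /continuous_closedP H := ca i; exact: (H [set x | 0 <= x] (@closed_ge R 0)).
  have /continuous_closedP H : continuous
      (fun v : T => energy (v.1 ord0 i) - 2 * n%:R * v.2 ord0 i ^+ 3).
    apply: continuous_sub.
      move=> v; apply: (@continuous_comp _ _ _ (fun v : T => v.1 ord0 i) (@energy R n)); first exact: cY.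
      exact: energy_continuous.
    apply: continuous_scale => v; apply: (@continuous_comp _ _ _ (fun v : T => v.2 ord0 i) (fun x => x ^+ 3)).
      exact: ca.
    exact: exprn_continuous.
  exact: (H [set x | x <= 0] (@closed_le R 0)).
have ccost : continuous cost by exact: sum_continuous.
have feas_box v : feas v -> cost v <= S + 1 -> box v.
  move=> [_ vP] cv.
  have a1 i : v.2 ord0 i <= S + 1.
    apply: le_trans cv; rewrite /cost (bigD1 i)//= lerDl.
    by apply: sumr_ge0 => k _; exact: (vP k).1.
  split=> i; last by rewrite /= in_itv/= (vP i).1 a1.
  move=> j; have := energy_bound j (vP i).1 (vP i).2 => Hj.
  have HB : modulus (v.1 ord0 i ord0 j) <= B.
    by rewrite (le_trans Hj)// ler_wpM2l.
  by split; rewrite (le_trans _ HB)// ?Re_le_modulus ?Im_le_modulus.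
have [|c [_ [c1 c2]] cmin] := compact_min cK _ ccost.
  have [v fv cv] := near 1 ltr01.
  by exists v; split=> //; exact: feas_box.
exists (fun i => c.1 ord0 i), (fun i => c.2 ord0 i); split=> //.
rewrite -/(cost c) leNgt; apply/negP => Sc.
have [e [e0 e1 e2]] : exists e : R, [/\ 0 < e, e <= 1 & e <= (cost c - S) / 2].
  exists (Num.min 1 ((cost c - S) / 2)).
  by rewrite lt_min ltr01 divr_gt0 ?subr_gt0// !ge_min !lexx orbT.
have [v fv cv] := near e e0.
have : cost c <= cost v.
  by apply: cmin; split=> //; apply: feas_box => //; lra.
lra.
Qed.

End Attained.

(** * Vertices, and a generic point of the span of 2n + 1 of them *)

Section Vertices.
Variables (R : realType) (n : nat).

Definition omega : Cplx R := Complex (- (1 / 2)) (Num.sqrt 3 / 2).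

Lemma omega2E : omega ^+ 2 = Complex (- (1 / 2)) (- (Num.sqrt 3 / 2)).
Proof.
have s3 : Num.sqrt 3 * Num.sqrt 3 = 3 :> R by rewrite -expr2 sqr_sqrtr.
apply/eqP; rewrite eq_complex /=; apply/andP; split; apply/eqP; last by field.
rewrite (_ : Num.sqrt 3 / 2 * (Num.sqrt 3 / 2) = Num.sqrt 3 * Num.sqrt 3 / 4); last by field.
by rewrite s3; field.
Qed.

Lemma omega3 : omega ^+ 3 = 1.
Proof.
have s3 : Num.sqrt 3 * Num.sqrt 3 = 3 :> R by rewrite -expr2 sqr_sqrtr.
rewrite exprS omega2E; apply/eqP; rewrite eq_complex /=.
apply/andP; split; apply/eqP; last by field.
rewrite (_ : Num.sqrt 3 / 2 * - (Num.sqrt 3 / 2) = - (Num.sqrt 3 * Num.sqrt 3 / 4)); last by field.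
by rewrite s3; field.
Qed.

Lemma omega_sum : 1 + omega + omega ^+ 2 = 0.
Proof.
rewrite omega2E; apply/eqP; rewrite eq_complex /=.
by apply/andP; split; apply/eqP; field.
Qed.

Lemma cube_rootP (a z : Cplx R) : z ^+ 3 = a ^+ 3 -> exists k : 'I_3, z = a * omega ^+ k.
Proof.
move=> za.
have : (z - a) * (z - a * omega) * (z - a * omega ^+ 2) = 0.
  rewrite (_ : _ * _ = z ^+ 3 - (1 + omega + omega ^+ 2) * a * z ^+ 2
    + (1 + omega + omega ^+ 2) * omega * a ^+ 2 * z - omega ^+ 3 * a ^+ 3); last by ring.
  by rewrite omega_sum omega3 za; ring.
move=> /eqP; rewrite !mulf_eq0 !subr_eq0 -orbA => /or3P[] /eqP ->.
- by exists ord0; rewrite expr0 mulr1.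
- by exists 1; rewrite expr1.
- by exists (inord 2); rewrite inordK.
Qed.

Definition vertex (u : {ffun 'I_n.+1 -> 'I_3}) : 'rV[Cplx R]_n.+1 :=
  \row_j (if j == ord0 then 1 else omega ^+ u j).

Lemma energy_vertex u : energy (vertex u) <= 2 * n%:R.
Proof.
rewrite /energy (eq_bigr (fun=> 2)) => [|j j0].
  by rewrite sumr_const (_ : #|_| = n) ?mulr_natr// cardC1 card_ord.
rewrite !mxE eqxx (negbTE j0) exprAC omega3 !expr1n subrr.
by rewrite modulus0 mulr0 add0r modulus_double modulus1 mulr1.
Qed.

(** The case of equality in [energy_ge_first]: all entries have the same cube. *)
Lemma energy_eq_vertex (Y : 'rV[Cplx R]_n.+1) (alpha : R) : 0 <= alpha ->
  Y ord0 ord0 = alpha%:C%C -> energy Y <= 2 * n%:R * alpha ^+ 3 ->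
  exists u, Y = (alpha%:C%C : Cplx R) *: vertex u.
Proof.
move=> a0 Y0 EY.
have := energy_ge_first Y; rewrite Y0 modulus_real ger0_norm// => EY'.
have /eqP : \sum_(j < n.+1 | j != ord0) modulus ((alpha%:C%C : Cplx R) ^+ 3 - Y ord0 j ^+ 3) = 0.
  apply/eqP; rewrite eq_le sumr_ge0 ?andbT => [|j _]; last exact: modulus_ge0.
  lra.
rewrite psumr_eq0 => [/allP YE|j _]; last exact: modulus_ge0.
have Yj j : j != ord0 -> exists k : 'I_3, Y ord0 j = (alpha%:C%C : Cplx R) * omega ^+ k.
  move=> j0; apply: cube_rootP; apply/eqP; rewrite eq_sym -subr_eq0 -modulus_eq0.
  by have := YE j (mem_index_enum _); rewrite j0.
have /choice[u uP] (j : 'I_n.+1) : exists k : 'I_3,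
    j != ord0 -> Y ord0 j = (alpha%:C%C : Cplx R) * omega ^+ k.
  have [->|j0] := eqVneq j ord0; first by exists ord0.
  by have [k kP] := Yj j j0; exists k.
exists [ffun j => u j]; apply/rowP => j; rewrite !mxE ffunE.
by have [->|j0] := eqVneq j ord0; rewrite ?mulr1// uP.
Qed.

(** The real coordinates of a vector: the real part of the first entry, followed,
for each other entry, by the two functionals that take the value [1] at one of the
nontrivial cube roots of unity and [0] at the two other ones (when the first entry is [1]). *)
Definition coords (Y : 'rV[Cplx R]_n.+1) : 'rV[R]_(2 * n).+1 :=
  \row_i (if i == ord0 then complex.Re (Y ord0 ord0) else
    (complex.Re (Y ord0 ord0) +
     2 * complex.Re (Y ord0 (inord (uphalf i)) * omega ^+ (odd i).+1)) / 3).

Lemma coordsZ (a : R) Y : coords ((a%:C%C : Cplx R) *: Y) = a *: coords Y.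
Proof.
apply/rowP => i; rewrite !mxE -mulrA !ReMc/= !mul0r !subr0.
by case: ifP => // _; ring.
Qed.

Lemma coords_sum (I : finType) (F : I -> 'rV[Cplx R]_n.+1) :
  coords (\sum_i F i) = \sum_i coords (F i).
Proof.
apply: (big_morph coords) => [Y Z|].
  apply/rowP => i; rewrite !mxE [(Y _ _ + Z _ _) * _]mulrDl !ReDc.
  by case: ifP => // _; ring.
by rewrite -(scaler0 _ (0%:C%C : Cplx R)) coordsZ scale0r.
Qed.

(** The moment curve uses the vertex with all entries [1] and those that differ
from it in one entry. *)
Definition base_vertex (i : nat) : {ffun 'I_n.+1 -> 'I_3} :=
  [ffun j : 'I_n.+1 => if i == (j.*2).-1 then inord 1 else if i == j.*2 then inord 2 else ord0].

(** The coordinates of the base vertices form a unitriangular matrix. *)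
Lemma coords_base_vertex (k i : 'I_(2 * n).+1) :
  coords (vertex (base_vertex k)) ord0 i = ((i == ord0) || (i == k))%:R.
Proof.
rewrite mxE; have [->|i0] := eqVneq i ord0; first by rewrite mxE eqxx.
have i0' : (0 < i)%N by rewrite lt0n; exact: i0.
have ik : (i == k) = (k == i :> nat) by rewrite eq_sym.
have j1 : (uphalf i < n.+1)%N by have := ltn_ord i; lia.
have j0 : (inord (uphalf i) == ord0 :> 'I_n.+1) = false.
  by apply/eqP => /(congr1 val); rewrite /= inordK//; lia.
rewrite !mxE eqxx j0 ffunE inordK// ik /=.
have s1 : complex.Re omega = - (1 / 2) by [].
have s2 : complex.Re (omega ^+ 2) = - (1 / 2) by rewrite omega2E.
have o4 : omega ^+ (2 + 2) = omega by rewrite (exprD _ 3 1) omega3 mul1r expr1.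
case: (boolP (odd i)) => oi.
  rewrite (_ : ((uphalf i).*2).-1 = i); last by lia.
  rewrite (_ : (uphalf i).*2 = i.+1); last by lia.
  case: eqP => ki; first by rewrite inordK// -exprD omega3/=; field.
  case: eqP => ki'.
    by rewrite inordK// -exprD [_ ^+ _]o4 s1/=; field.
  by rewrite expr0 mul1r s2/=; field.
rewrite (_ : ((uphalf i).*2).-1 = i.-1); last by lia.
rewrite (_ : (uphalf i).*2 = i); last by lia.
case: eqP => ki.
  rewrite (_ : (nat_of_ord k == i) = false); last by apply/eqP; lia.
  by rewrite inordK// -exprD s2/=; field.
case: eqP => ki'; first by rewrite inordK// -exprD omega3/=; field.
by rewrite expr0 mul1r expr1 s1/=; field.
Qed.

Definition moment_point (t : R) : 'rV[Cplx R]_n.+1 :=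
  \sum_(i < (2 * n).+1) ((t ^+ i)%:C%C : Cplx R) *: vertex (base_vertex i).

Lemma moment_point_first t :
  (moment_point t) ord0 ord0 = (\sum_(i < (2 * n).+1) t ^+ i)%:C%C.
Proof.
rewrite /moment_point summxE rmorph_sum/=; apply: eq_bigr => i _.
by rewrite !mxE eqxx mulr1.
Qed.

(** Each choice of [2 * n] vertices spans a proper real subspace, which the moment
curve meets at finitely many parameters. *)
Lemma moment_point_generic : exists2 t : R, 0 < t &
  forall (tau : 'I_(2 * n) -> {ffun 'I_n.+1 -> 'I_3}) (alpha : 'I_(2 * n) -> R),
    \sum_s ((alpha s)%:C%C : Cplx R) *: vertex (tau s) <> moment_point t.
Proof.
have kill (tau : {ffun 'I_(2 * n) -> {ffun 'I_n.+1 -> 'I_3}}) :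
    exists c : 'cV[R]_(2 * n).+1, c != 0 /\
      forall s, coords (vertex (tau s)) *m c = 0.
  pose A := \matrix_s coords (vertex (tau s)).
  have /rowV0Pn[v /sub_kermxP vA v0] : kermx A^T != 0.
    rewrite kermx_eq0 /row_free neq_ltn (leq_ltn_trans (rank_leq_col _))//.
  exists v^T; split; first by rewrite -(inj_eq (@trmx_inj _ _ _)) trmxK trmx0.
  move=> s; have := congr1 (fun M => row s M^T) vA.
  by rewrite trmx_mul trmxK row_mul rowK => ->; rewrite trmx0 row0.
have [c /all_and2[c0 cP]] := choice kill.
pose P tau := \poly_(i < (2 * n).+1) (coords (vertex (base_vertex i)) *m c tau) ord0 ord0.
have P0 tau : P tau != 0.
  apply: contraNneq (c0 tau) => Pz; apply/eqP/colP => i; rewrite mxE.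
  have Pi (k : 'I_(2 * n).+1) : c tau ord0 ord0 + (k != ord0)%:R * c tau k ord0 = 0.
    have := congr1 (fun p : {poly R} => p`_k) Pz; rewrite coef_poly ltn_ord coef0 => <-.
    rewrite mxE (bigD1 ord0)//= coords_base_vertex eqxx mul1r; congr (_ + _).
    have [->|k0] := eqVneq k ord0.
      rewrite mul0r big1// => l l0.
      by rewrite coords_base_vertex (negbTE l0) mul0r.
    rewrite (bigD1 k)//= coords_base_vertex eqxx orbT big1 ?addr0// => l /andP[l0 lk].
    by rewrite coords_base_vertex (negbTE l0) (negbTE lk) mul0r.
  have C0 : c tau ord0 ord0 = 0 by have := Pi ord0; rewrite eqxx mul0r addr0.
  have [->//|i0] := eqVneq i ord0.
  by have := Pi i; rewrite i0 C0 add0r mul1r.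
have [t t0 tP] : exists2 t : R, 0 < t & forall tau, (P tau).[t] != 0.
  (* there are finitely many choices of vertices, hence one polynomial that
     vanishes at all exceptional parameters *)
  pose Q := \prod_tau P tau.
  have Q0 : Q != 0 by apply/prodf_neq0 => tau _; exact: P0.
  have [k kQ] : exists k : nat, ~~ root Q k.+1%:R.
    apply: contrapT => /forallNP Qr.
    have := @max_poly_roots _ Q [seq k.+1%:R | k <- iota 0 (size Q)] Q0.
    rewrite size_map size_iota ltnn => H.
    have : false.
      apply: H.
        by apply/allP => _ /mapP[k _ ->]; apply: contrapT => /negP; exact: Qr.
      rewrite map_inj_uniq ?iota_uniq// => x y /eqP; rewrite eqr_nat => /eqP[].
      by [].
    by [].
  exists k.+1%:R => // tau; apply: contraNneq kQ => Pt.
  by rewrite /root /Q horner_prod (bigD1 tau)//= Pt mul0r.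
exists t => // tau alpha E.
pose tauf : {ffun 'I_(2 * n) -> {ffun 'I_n.+1 -> 'I_3}} := [ffun s => tau s].
have /eqP := tP tauf; apply.
have -> : (P tauf).[t] = (coords (moment_point t) *m c tauf) ord0 ord0.
  rewrite horner_poly coords_sum mulmx_suml summxE; apply: eq_bigr => i _.
  by rewrite coordsZ -scalemxAl [RHS]mxE mulrC.
rewrite -E coords_sum mulmx_suml summxE big1// => s _.
rewrite coordsZ -scalemxAl mxE -[tau s](ffunE tau) cP mxE mulr0.
by [].
Qed.

End Vertices.

(** * Failure of the equality with 2n summands *)

Lemma seminorm_sum (R : realType) (n : nat) (p : 'rV[Cplx R]_n -> R) (I : finType)
    (F : I -> 'rV[Cplx R]_n) :
  seminorm p -> p (\sum_i F i) <= \sum_i p (F i).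
Proof.
move=> [_ pZ pD]; elim/big_rec2: _ => [|i y Y _ IH].
  have := pZ 0 0; rewrite scale0r -/(modulus 0) modulus0 mul0r => ->.
  by [].
by rewrite (le_trans (pD _ _))// lerD2l.
Qed.

Lemma buseman_moment_point_le (R : realType) (n : nat) (t : R) : (0 < n)%N -> 0 <= t ->
  kobayashi_buseman (@Dn R n) 0 (moment_point n t) <= \sum_(i < (2 * n).+1) t ^+ i.
Proof.
move=> n0 t0; have [sb _] := kobayashi_buseman_largest (@Dn R n) 0.
have [[_ pZ _] pk] := sb; have [sp _] := sb.
rewrite (le_trans (seminorm_sum _ sp))//; apply: ler_sum => i _.
rewrite pZ -/(modulus _) modulus_real ger0_norm ?exprn_ge0//.
rewrite ler_piMr ?exprn_ge0// (le_trans (pk _))//.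
by apply: kobayashi_royden_Dn_le1 => //; exact: energy_vertex.
Qed.

(** The first entry of the point is the sum of the weights [t ^+ i].  A
decomposition of that cost would satisfy
[\sum_s alpha s <= Re (\sum_s Y s ord0 ord0)], whereas each term satisfies
[Re (Y s ord0 ord0) <= modulus (Y s ord0 ord0) <= alpha s]; equality in all of
these leaves only multiples of vertices. *)
Lemma kobayashi_moment_point_gt (R : realType) (n : nat) (t : R) : (0 < n)%N ->
  (forall (tau : 'I_(2 * n) -> {ffun 'I_n.+1 -> 'I_3}) (alpha : 'I_(2 * n) -> R),
    \sum_s ((alpha s)%:C%C : Cplx R) *: vertex R (tau s) <> moment_point n t) ->
  \sum_(i < (2 * n).+1) t ^+ i < kobayashi (2 * n) (@Dn R n) 0 (moment_point n t).
Proof.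
move=> n0 generic; rewrite ltNge; apply/negP => kS.
have [|Y [alpha [YX aS Ya]]] := kobayashi_Dn_attained n0 _ kS; first by rewrite muln_gt0.
have Y0 s : modulus (Y s ord0 ord0) <= alpha s.
  by have [a0 EY] := Ya s; exact: modulus_first_le.
have d0 s : 0 <= alpha s - complex.Re (Y s ord0 ord0).
  by rewrite subr_ge0 (le_trans (ler_norm _))// (le_trans (Re_le_modulus _)).
have /eqP : \sum_s (alpha s - complex.Re (Y s ord0 ord0)) = 0.
  apply/eqP; rewrite eq_le sumr_ge0 ?andbT// sumrB -Re_sum.
  have -> : \sum_s Y s ord0 ord0 = moment_point n t ord0 ord0 by rewrite -YX summxE.
  by rewrite moment_point_first subr_le0.
rewrite psumr_eq0// => /allP YE.
have Yv s : exists u, Y s = ((alpha s)%:C%C : Cplx R) *: vertex R u.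
  have [a0 EY] := Ya s; apply: energy_eq_vertex => //.
  have /eqP := YE s (mem_index_enum _); move: (Y0 s).
  (* a number whose real part is at least its modulus is real *)
  case: (Y s ord0 ord0) => x y; rewrite /= => xy /eqP; rewrite subr_eq0 => /eqP ax.
  rewrite ax in xy a0 *; congr Complex; apply/eqP; rewrite -sqrf_eq0 -[_ == 0]andTb.
  move: xy; rewrite modulusRI -(@ler_pXn2r _ 2) ?nnegrE ?sqrtr_ge0//.
  rewrite sqr_sqrtr ?addr_ge0 ?sqr_ge0// gerDl => y0.
  by rewrite eq_le y0 sqr_ge0.
have [tau tauP] := choice Yv.
by apply: (generic tau alpha); rewrite -YX; apply: eq_bigr => s _; rewrite -tauP.
Qed.

Lemma kobayashi_Dn_neq_buseman (R : realType) (n : nat) : (0 < n)%N ->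
  kobayashi (2 * n) (@Dn R n) 0 <> kobayashi_buseman (@Dn R n) 0.
Proof.
move=> n0 E; have [t t0 generic] := moment_point_generic R n.
have := kobayashi_moment_point_gt n0 generic.
by rewrite E ltNge buseman_moment_point_le// ltW.
Qed.

(** * Optimal decompositions *)

Section DropVector.
Variables (R : realType) (n : nat).
Notation V := 'rV[Cplx R]_n.

Definition balanced (h : V -> R) : Prop :=
  (forall X, 0 <= h X) /\ forall (a : Cplx R) X, h (a *: X) = modulus a * h X.

Lemma balanced0 (h : V -> R) : balanced h -> h 0 = 0.
Proof. by move=> [_ hZ]; rewrite -(scale0r 0) hZ modulus0 mul0r. Qed.

(** The modulus to first order, from [2 * r <= 1 + r ^+ 2] at
[r = modulus (1 + z)]. *)
Let modulus_1D (z : Cplx R) : modulus (1 + z) <= 1 + complex.Re z + modulus z ^+ 2 / 2.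
Proof.
have m2 (y : Cplx R) : modulus y ^+ 2 = complex.Re y ^+ 2 + complex.Im y ^+ 2.
  by case: y => a b; rewrite modulusRI sqr_sqrtr// addr_ge0 ?sqr_ge0.
have := m2 (1 + z); rewrite (m2 z) ReDc ImDc /= add0r.
have : 0 <= (modulus (1 + z) - 1) ^+ 2 by rewrite sqr_ge0.
rewrite sqrrB1; lra.
Qed.

Section Stationary.
Variables (m : nat) (x : 'I_m -> V) (w : 'I_m -> R).
Hypothesis w_gt0 : forall j, 0 < w j.
Hypothesis w_min : forall d : 'I_m -> Cplx R, \sum_j d j *: x j = 0 ->
  \sum_j w j <= \sum_j modulus (1 + d j) * w j.

Let stationary_ge0 (d : 'I_m -> Cplx R) : \sum_j d j *: x j = 0 ->
  0 <= \sum_j complex.Re (d j) * w j.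
Proof.
move=> dx; rewrite leNgt; apply/negP => s0.
set s := \sum_j _ in s0; pose q := \sum_j modulus (d j) ^+ 2 * w j.
have q0 : 0 <= q by apply: sumr_ge0 => j _; rewrite mulr_ge0 ?sqr_ge0 ?ltW.
have H (e : R) : 0 < e -> 0 <= e * s + e ^+ 2 * q / 2.
  move=> e0.
  have /w_min : \sum_j ((e%:C%C : Cplx R) * d j) *: x j = 0.
    by under eq_bigr do rewrite -scalerA; rewrite -scaler_sumr dx scaler0.
  rewrite -subr_ge0 -sumrB => H; apply: (le_trans H).
  rewrite [e * s]mulr_sumr -mulrA /q mulr_suml mulr_sumr -big_split/=.
  apply: ler_sum => j _; rewrite -{2}[w j]mul1r -mulrBl.
  have := modulus_1D ((e%:C%C : Cplx R) * d j).
  rewrite ReMc modulusM modulus_real gtr0_norm//= mul0r subr0 exprMn => H1.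
  rewrite [leRHS](_ : _ = (e * complex.Re (d j) + e ^+ 2 * modulus (d j) ^+ 2 / 2) * w j); last by ring.
  by apply: ler_wpM2r; [exact: ltW|lra].
have q1 : 0 < q + 1 by rewrite ltr_wpDl.
(* a step at which the quadratic term is at most half of the linear one *)
have := H (- s / (q + 1)); rewrite divr_gt0 ?oppr_gt0// => /(_ isT).
rewrite leNgt => /negP; apply.
rewrite [ltLHS](_ : _ = - (s ^+ 2 / (q + 1)) * (1 - q / (q + 1) / 2)); last first.
  by field; rewrite gt_eqF.
rewrite mulNr oppr_lt0 mulr_gt0//.
  by rewrite divr_gt0// exprn_even_gt0//= lt_eqF.
have : q / (q + 1) <= 1 by rewrite ler_pdivrMr// mul1r lerDl.
lra.
Qed.

Lemma stationary_re (d : 'I_m -> Cplx R) : \sum_j d j *: x j = 0 ->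
  \sum_j complex.Re (d j) * w j = 0.
Proof.
move=> dx; apply/eqP; rewrite eq_le stationary_ge0// andbT -oppr_ge0 -sumrN.
rewrite (eq_bigr (fun j => complex.Re (- d j) * w j)) => [|j _]; last first.
  by case: (d j) => a b /=; rewrite mulNr.
apply: stationary_ge0; under eq_bigr do rewrite scaleNr.
by rewrite sumrN dx oppr0.
Qed.

Let stationary (d : 'I_m -> Cplx R) : \sum_j d j *: x j = 0 ->
  \sum_j d j * (w j)%:C%C = 0.
Proof.
move=> dx; apply/eqP; rewrite eq_complex Re_sum Im_sum; apply/andP; split; apply/eqP.
  rewrite -[RHS](stationary_re dx); apply: eq_bigr => j _.
  by rewrite ReMc /= mulr0 subr0.
(* the imaginary part is the real part of the relation multiplied by [- 'i] *)
have idx : \sum_j ((0 -i* 1)%C * d j : Cplx R) *: x j = 0.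
  by under eq_bigr do rewrite -scalerA; rewrite -scaler_sumr dx scaler0.
rewrite -[RHS](stationary_re idx); apply: eq_bigr => j _.
by rewrite ReMc ImMc /=; ring.
Qed.

(** The vectors of an optimal decomposition lie in the real hyperplane where the
supporting complex functional is real; this is where one vector is gained over the
count given by Caratheodory's theorem. *)
Lemma stationary_dependent : (0 < m)%N -> (2 * n <= m)%N ->
  exists c : 'I_m -> R, (exists j, c j != 0) /\
    \sum_j ((c j)%:C%C : Cplx R) *: x j = 0.
Proof.
move=> m0 nm.
pose B : 'M[Cplx R]_(m, n) := \matrix_j x j.
pose W : 'cV[Cplx R]_m := \col_j (w j)%:C%C.
have mulB (d : 'rV[Cplx R]_m) : d *m B = \sum_j d ord0 j *: x j.
  by rewrite mulmx_sum_row; apply: eq_bigr => j _; rewrite rowK.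
have [l lW] : exists l : 'cV[Cplx R]_n, W = B *m l.
  have : (W^T <= B^T)%MS.
    rewrite submxE; apply/eqP/trmx_inj; rewrite trmx_mul trmxK trmx0.
    apply/row_matrixP => i; rewrite row_mul row0; set d := row i _.
    have dB : d *m B = 0.
      rewrite -[B]trmxK /d -row_mul -trmx_mul mulmx_coker trmx0.
      by rewrite row0.
    rewrite mulB in dB; have := stationary dB.
    move=> H; apply/rowP => k; rewrite !mxE -[RHS]H.
    by apply: eq_bigr => j _; rewrite !mxE.
  move=> /submxP[D WD]; exists D^T.
  by rewrite -[W]trmxK WD trmx_mul trmxK.
pose A : 'M[R]_(m, n + n) := row_mx (map_mx (@complex.Re R) B) (map_mx (@complex.Im R) B).
pose v : 'cV[R]_(n + n) := col_mx (map_mx (@complex.Im R) l) (map_mx (@complex.Re R) l).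
have Av : A *m v = 0.
  rewrite mul_row_col; apply/colP => j; rewrite !mxE -big_split/=.
  have := congr1 (fun M : 'cV_m => complex.Im (M j ord0)) lW.
  rewrite !mxE /= => H; rewrite [RHS]H Im_sum; apply: eq_bigr => k _.
  by rewrite !mxE ImMc.
have v0 : v != 0.
  apply/eqP => v0; have j : 'I_m := Ordinal m0.
  have l0 : l = 0.
    have [l1 l2] : map_mx (@complex.Im R) l = 0 /\ map_mx (@complex.Re R) l = 0.
      by apply: eq_col_mx; rewrite col_mx0.
    apply/colP => k; apply/eqP; rewrite eq_complex.
    have := congr1 (fun M : 'cV_n => M k ord0) l1; rewrite !mxE => ->.
    have := congr1 (fun M : 'cV_n => M k ord0) l2; rewrite !mxE => ->.
    by rewrite !eqxx.
  have := w_gt0 j; have := congr1 (fun M : 'cV_m => complex.Re (M j ord0)) lW.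
  by rewrite l0 mulmx0 !mxE /= => ->; rewrite ltxx.
have /rowV0Pn[c /sub_kermxP cA c0] : kermx A != 0.
  rewrite kermx_eq0 /row_free neq_ltn; apply/orP; left.
  have := rank_leq_col A; rewrite leq_eqVlt => /orP[|rA]; last first.
    by rewrite (leq_trans rA)// addnn -mul2n.
  move=> /row_fullP[C CA]; case/eqP: v0.
  by rewrite -[v]mul1mx -CA -mulmxA Av mulmx0.
exists (fun j => c ord0 j); split.
  by have /rV0Pn[j cj] := c0; exists j.
move: cA; rewrite mul_mx_row -row_mx0 => /eq_row_mx[cR cI].
apply/rowP => k; rewrite summxE mxE; apply/eqP; rewrite eq_complex Re_sum Im_sum.
have := congr1 (fun M : 'rV_n => M ord0 k) cR; rewrite !mxE => H1.
have := congr1 (fun M : 'rV_n => M ord0 k) cI; rewrite !mxE => H2.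
apply/andP; split; apply/eqP.
  by rewrite -[RHS]H1; apply: eq_bigr => j _; rewrite !mxE ReMc/= mul0r subr0.
by rewrite -[RHS]H2; apply: eq_bigr => j _; rewrite !mxE ImMc/= mul0r addr0.
Qed.

End Stationary.
End DropVector.

(** * Shortening decompositions *)

Section Reduction.
Variables (R : realType) (n : nat).
Notation V := 'rV[Cplx R]_n.

Let drop_zero (g : V -> R) m (X : 'I_m.+1 -> V) i : g 0 = 0 -> X i = 0 ->
  exists Y : 'I_m -> V, \sum_j Y j = \sum_j X j /\ \sum_j g (Y j) = \sum_j g (X j).
Proof.
move=> g0 Xi; exists (fun j => X (lift i j)).
by split; rewrite [RHS](bigD1_ord i)//= Xi ?g0 add0r.
Qed.

(** The weights being positive, the coefficients that cost no more than the
constant [1] lie in a compact box. *)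
Let optimal_coefficients (m : nat) (X : 'I_m -> V) (w : 'I_m -> R) :
  (forall j, 0 < w j) ->
  exists2 a : 'I_m -> Cplx R, \sum_j a j *: X j = \sum_j X j &
    forall b : 'I_m -> Cplx R, \sum_j b j *: X j = \sum_j X j ->
      \sum_j modulus (a j) * w j <= \sum_j modulus (b j) * w j.
Proof.
move=> w0.
pose cost (a : 'rV[Cplx R]_m) : R := \sum_j modulus (a ord0 j) * w j.
pose F1 := \sum_j w j.
pose box (j : 'I_m) : set (Cplx R) :=
  [set z | `|complex.Re z| <= F1 / w j /\ `|complex.Im z| <= F1 / w j].
pose feas : set 'rV[Cplx R]_m := [set a | \sum_j a ord0 j *: X j = \sum_j X j].
have cK : compact ([set a : 'rV[Cplx R]_m | forall j, box j (a ord0 j)] `&` feas).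
  apply: compact_closedI.
    by apply: (@rV_compact (Cplx R) m box) => j; exact: compact_square.
  have /continuous_closedP H : continuous (fun a : 'rV[Cplx R]_m => \sum_j a ord0 j *: X j).
    apply: sum_continuous => j; apply: continuous_scalel; exact: coord_continuous.
  apply: (H [set \sum_j X j]); apply: accessible_closed_set1; apply: hausdorff_accessible.
  exact: norm_hausdorff.
have ccost : continuous cost.
  apply: sum_continuous => j.
  rewrite (_ : (fun _ => _) = (fun a : 'rV[Cplx R]_m => w j * modulus (a ord0 j))); last first.
    by apply/funext => a; rewrite mulrC.
  apply: continuous_scale => a.
  apply: (@continuous_comp _ _ _ (fun a : 'rV[Cplx R]_m => a ord0 j) (@modulus R)).
    exact: coord_continuous.
  exact: modulus_continuous.
have cheap_box (a : 'rV[Cplx R]_m) : cost a <= F1 -> forall j, box j (a ord0 j).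
  move=> ca j.
  have aj : modulus (a ord0 j) <= F1 / w j.
    rewrite ler_pdivlMr// (le_trans _ ca)// /cost (bigD1 j)//= lerDl.
    by apply: sumr_ge0 => k _; rewrite mulr_ge0 ?modulus_ge0// ltW.
  by split; rewrite (le_trans _ aj)// ?Re_le_modulus ?Im_le_modulus.
have cost1 : cost (const_mx 1) = F1.
  by apply: eq_bigr => j _; rewrite mxE modulus1 mul1r.
have feas1 : feas (const_mx 1).
  by apply: eq_bigr => j _; rewrite mxE scale1r.
have [|a [_ fa] amin] := compact_min cK _ ccost.
  by exists (const_mx 1); split=> //; apply: cheap_box; rewrite cost1.
have aF : cost a <= F1.
  by rewrite -cost1; apply: amin; split=> //; apply: cheap_box; rewrite cost1.
exists (fun j => a ord0 j) => // b fb.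
pose b' : 'rV[Cplx R]_m := \row_j b j.
have -> : \sum_j modulus (b j) * w j = cost b'.
  by apply: eq_bigr => j _; rewrite mxE.
rewrite -/(cost a) leNgt; apply/negP => ba.
have : cost a <= cost b'.
  apply: amin; split; first by apply: cheap_box; rewrite (le_trans (ltW ba)).
  by rewrite /feas/= -[RHS]fb; apply: eq_bigr => j _; rewrite mxE.
by rewrite leNgt ba.
Qed.

(** An optimal recombination in which no term vanishes is moved along a real
dependency of its terms, at constant cost, until a coefficient vanishes. *)
Let drop_one (g : V -> R) m (X : 'I_m.+1 -> V) : balanced g ->
  (forall Y, Y != 0 -> 0 < g Y) -> (2 * n <= m.+1)%N ->
  exists Y : 'I_m -> V, \sum_j Y j = \sum_j X j /\ \sum_j g (Y j) <= \sum_j g (X j).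
Proof.
move=> bg gpos nm; have g0 := balanced0 bg; have [gge0 gZ] := bg.
have drop (Z : 'I_m.+1 -> V) i : Z i = 0 -> \sum_j Z j = \sum_j X j ->
    \sum_j g (Z j) <= \sum_j g (X j) -> exists Y : 'I_m -> V,
    \sum_j Y j = \sum_j X j /\ \sum_j g (Y j) <= \sum_j g (X j).
  move=> Zi ZX gZX; have [Y [YZ gYZ]] := drop_zero g0 Zi.
  by exists Y; rewrite YZ gYZ.
have [[i /eqP Xi]|X0] := pselect (exists i, X i == 0); first exact: (drop X i).
have {X0}Xpos i : 0 < g (X i).
  by apply: gpos; apply/negP => Xi; apply: X0; exists i.
have [a aX amin] := optimal_coefficients X Xpos.
pose x j := a j *: X j; pose w j := g (x j).
have wE j : w j = modulus (a j) * g (X j) by rewrite /w gZ.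
have wle : \sum_j w j <= \sum_j g (X j).
  under eq_bigr do rewrite wE.
  have -> : \sum_j g (X j) = \sum_j modulus 1 * g (X j).
    by apply: eq_bigr => j _; rewrite modulus1 mul1r.
  by apply: (amin (fun=> 1)); apply: eq_bigr => j _; rewrite scale1r.
have [[i /eqP xi]|x0] := pselect (exists i, x i == 0); first exact: (drop x i).
have {x0}wpos i : 0 < w i.
  by apply: gpos; apply/negP => xi; apply: x0; exists i.
have wmin (d : 'I_m.+1 -> Cplx R) : \sum_j d j *: x j = 0 ->
    \sum_j w j <= \sum_j modulus (1 + d j) * w j.
  move=> dx; under eq_bigr do rewrite wE.
  under [leRHS]eq_bigr do rewrite wE mulrA -modulusM.
  apply: amin; under eq_bigr do rewrite mulrDl mul1r scalerDl -scalerA.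
  by rewrite big_split/= aX dx addr0.
have [c [[k ck] cx]] := stationary_dependent wpos wmin isT nm.
have cw : \sum_j c j * w j = 0 by exact: (stationary_re wpos wmin cx).
have [i ci] : exists i, forall j, c j <= c i.
  exists [arg max_(i > (ord0 : 'I_m.+1)) c i]%O => j.
  by case: Order.TotalTheory.arg_maxP => // y _; apply.
have ci0 : 0 < c i.
  rewrite ltNge; apply/negP => ci0.
  have : \sum_j c j * w j < 0.
    rewrite (bigD1 k)//= ltr_wnDr//.
      apply: sumr_le0 => j _; rewrite mulr_le0_ge0 ?(ltW (wpos j))//.
      exact: le_trans (ci j) ci0.
    rewrite nmulr_rlt0// lt_neqAle ck; exact: le_trans (ci k) ci0.
  by rewrite cw ltxx.
pose t j : R := 1 - c j / c i.
have t0 j : 0 <= t j by rewrite subr_ge0 ler_pdivrMr// mul1r.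
apply: (drop (fun j => ((t j)%:C%C : Cplx R) *: x j) i).
- by rewrite /t divff ?gt_eqF// subrr scale0r.
- have tE j : ((t j)%:C%C : Cplx R) *: x j =
      x j - ((c i)^-1%:C%C : Cplx R) *: (((c j)%:C%C : Cplx R) *: x j).
    by rewrite /t rmorphB rmorph1 scalerBl scale1r scalerA -rmorphM/= mulrC.
  by under eq_bigr do rewrite tE; rewrite sumrB -scaler_sumr cx scaler0 subr0 aX.
rewrite (le_trans _ wle)//; under eq_bigr do rewrite gZ modulus_real ger0_norm// -/(w _).
under eq_bigr do rewrite /t mulrBl mul1r mulrAC.
by rewrite sumrB -mulr_suml cw mul0r subr0.
Qed.

Let reduce_positive (g : V -> R) N k (X : 'I_(k + N) -> V) : balanced g ->
  (forall Y, Y != 0 -> 0 < g Y) -> (2 * n <= N.+1)%N ->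
  exists Y : 'I_N -> V, \sum_j Y j = \sum_j X j /\ \sum_j g (Y j) <= \sum_j g (X j).
Proof.
move=> bg gpos nN; elim: k X => [|k IH] X; first by exists X.
have [|Y [YX gYX]] := @drop_one g (k + N) X bg gpos.
  by rewrite (leq_trans nN)// ltnS leq_addl.
have [Z [ZY gZY]] := IH Y; exists Z; rewrite ZY YX; split=> //.
exact: le_trans gYX.
Qed.

Let l1norm (X : V) : R := \sum_i modulus (X ord0 i).

Let l1norm_balanced : balanced l1norm.
Proof.
split=> [X|a X]; first by apply: sumr_ge0 => i _; exact: modulus_ge0.
by rewrite /l1norm mulr_sumr; apply: eq_bigr => i _; rewrite mxE modulusM.
Qed.

Let l1norm_gt0 X : X != 0 -> 0 < l1norm X.
Proof.
move=> /rV0Pn[i Xi]; rewrite /l1norm (bigD1 i)//= ltr_pwDl ?modulus_gt0//.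
by apply: sumr_ge0 => j _; exact: modulus_ge0.
Qed.

(** The reduction is applied to [h + eta * l1norm], which is positive outside [0],
with [eta] so small that the norm contributes at most [e]. *)
Lemma balanced_reduce (h : V -> R) N k (X : 'I_(k + N) -> V) (e : R) : balanced h ->
  (2 * n <= N.+1)%N -> 0 < e -> exists Y : 'I_N -> V,
    \sum_j Y j = \sum_j X j /\ \sum_j h (Y j) <= \sum_j h (X j) + e.
Proof.
move=> [h0 hZ] nN e0; have [l0 lZ] := l1norm_balanced.
pose S := \sum_j l1norm (X j).
have S0 : 0 <= S by exact: sumr_ge0.
have S1 : 0 < S + 1 by rewrite ltr_wpDl.
pose eta : R := e / (S + 1); have eta0 : 0 < eta by rewrite divr_gt0.
pose g (Y : V) := h Y + eta * l1norm Y.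
have bg : balanced g.
  split=> [Y|a Y]; first by apply: addr_ge0 => //; rewrite mulr_ge0// ltW.
  by rewrite /g hZ lZ; ring.
have gpos Y : Y != 0 -> 0 < g Y.
  by move=> Y0; rewrite /g ltr_wpDl// mulr_gt0// l1norm_gt0.
have [Y [YX gYX]] := reduce_positive X bg gpos nN.
exists Y; split=> //; apply: (@le_trans _ _ (\sum_j g (Y j))).
  by apply: ler_sum => j _; rewrite lerDl mulr_ge0// ltW.
rewrite (le_trans gYX)// /g big_split/= -mulr_sumr lerD2l.
by rewrite /eta -/S mulrAC ler_pdivrMr// ler_pM2l// lerDl.
Qed.

End Reduction.

(** * Equality with 2n - 1 summands *)

Lemma derive1_comp_mul (K : numFieldType) (W : normedModType K) (f : K -> W) (v : K) :
  differentiable f 0 -> derive1 (f \o *%R v) 0 = v *: derive1 f 0.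
Proof.
move=> df.
have dv : is_diff (0 : K) ( *%R v : K -> K) ( *%R v : K -> K) by exact: (is_diff_scaler v 0).
have vd : differentiable ( *%R v : K -> K) (0 : K) by exact: ex_diff.
have df' : differentiable f (v * 0) by rewrite mulr0.
rewrite derive1E'; last exact: differentiable_comp.
rewrite (diff_comp vd df') /= mulr0 diff_val mulr1.
by rewrite deriv1E//; apply/derivable1_diffP.
Qed.

Section KobayashiSeminorm.
Variables (R : realType) (n : nat) (D : set 'rV[Cplx R]_n) (z : 'rV[Cplx R]_n).
Hypothesis Dz : D z.
Notation V := 'rV[Cplx R]_n.

Let discs (X : V) : set R := [set alpha : R | 0 <= alpha /\
  exists phi : Cplx R -> 'rV[Cplx R]_n,
    [/\ holomorphic_disc D phi, phi 0 = z
      & (alpha%:C%C : Cplx R) *: derive1 phi 0 = X]].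

(** The disc is rotated by [v], the phase of [u]. *)
Let discs_rotate (u : Cplx R) (X : V) alpha : u != 0 ->
  discs X alpha -> discs (u *: X) (modulus u * alpha).
Proof.
move=> u0 [a0 [phi [hphi phi0 phiX]]]; split; first by rewrite mulr_ge0 ?modulus_ge0.
pose v : Cplx R := u / (modulus u)%:C%C.
have mu0 : modulus u != 0 by rewrite modulus_eq0.
have mu0' : ((modulus u)%:C%C : Cplx R) != 0 by rewrite -modulus_eq0 modulus_real normr_eq0.
have v1 : `|v| = 1.
  rewrite -modulusE /v modulusM modulusV modulus_real ger0_norm ?modulus_ge0//.
  by rewrite divff// rmorph1.
have dv (t : Cplx R) : is_diff t ( *%R v : Cplx R -> Cplx R) ( *%R v : Cplx R -> Cplx R).
  exact: (is_diff_scaler v t).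
have disc_v (t : Cplx R) : unit_disc t -> unit_disc (v * t).
  by rewrite /unit_disc/= normrM v1 mul1r.
have dphi (t : Cplx R) : unit_disc t -> differentiable phi t.
  by move=> /hphi[/derivable1_diffP].
exists (phi \o *%R v); split.
- move=> t ut; split; last by have [] := hphi _ (disc_v _ ut).
  apply/derivable1_diffP/differentiable_comp; first exact: ex_diff.
  exact/dphi/disc_v.
- by rewrite /= mulr0.
have u00 : unit_disc (0 : Cplx R) by rewrite /unit_disc/= normr0.
have dE : derive1 (phi \o *%R v) 0 = v *: derive1 phi 0.
  by rewrite derive1_comp_mul//; exact: dphi.
rewrite dE scalerA -phiX scalerA; congr (_ *: _).
by rewrite rmorphM/= /v; field.
Qed.

Lemma kobayashi_royden_balanced : balanced (kobayashi_royden D z).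
Proof.
have k0 X : 0 <= kobayashi_royden D z X by exact: kobayashi_royden_ge0.
split=> //.
have lbd X : has_lbound (discs X) by exists 0 => y [].
have kle (u : Cplx R) X : u != 0 ->
    kobayashi_royden D z (u *: X) <= modulus u * kobayashi_royden D z X.
  move=> u0; have mu : 0 < modulus u by rewrite modulus_gt0.
  have [d0|/set0P dX] := eqVneq (discs X) set0.
    have E0 Y : discs Y = set0 -> kobayashi_royden D z Y = 0.
      by rewrite /kobayashi_royden -/(discs Y) => ->; rewrite inf0.
    rewrite !E0 ?mulr0//; apply/seteqP; split=> // a da.
    have := @discs_rotate u^-1 (u *: X) a.
    by rewrite invr_eq0 scalerA mulVf// scale1r d0 => /(_ u0 da).
  rewrite -ler_pdivrMl//; apply: lb_le_inf => // a da.
  by rewrite ler_pdivrMl//; apply: ge_inf; [exact: lbd|exact: discs_rotate].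
move=> u X; have [->|u0] := eqVneq u 0.
  rewrite scale0r modulus0 mul0r; apply/eqP; rewrite eq_le k0 andbT.
  apply: ge_inf; first exact: lbd.
  split=> //; exists (cst z); split=> //.
  by rewrite rmorph0 scale0r.
apply/eqP; rewrite eq_le kle//= -ler_pdivlMl ?modulus_gt0//.
rewrite -modulusV; have := @kle u^-1 (u *: X).
by rewrite scalerA mulVf// scale1r; apply; rewrite invr_eq0.
Qed.

Let sums m (X : V) : set R := [set \sum_(j < m) kobayashi_royden D z (Y j) |
  Y in [set Y : 'I_m -> V | \sum_(j < m) Y j = X]].

Let sums_lb m X : has_lbound (sums m X).
Proof.
by exists 0 => _ [Y _ <-]; apply: sumr_ge0 => j _; exact: kobayashi_royden_ge0.
Qed.

Let kobayashi_le m (Y : 'I_m -> V) :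
  kobayashi m D z (\sum_j Y j) <= \sum_j kobayashi_royden D z (Y j).
Proof. by apply: ge_inf; [exact: sums_lb|exists Y]. Qed.

Let single m (X : V) : (0 < m)%N -> exists2 Y : 'I_m -> V, \sum_j Y j = X &
  \sum_j kobayashi_royden D z (Y j) = kobayashi_royden D z X.
Proof.
case: m => // m _; exists (fun j => if j == ord0 then X else 0).
  by rewrite -big_mkcond big_pred1_eq.
have k00 := balanced0 kobayashi_royden_balanced.
by rewrite (bigD1 ord0)//= big1 ?addr0// => j /negbTE ->.
Qed.

Let sums_neq0 m X : (0 < m)%N -> sums m X !=set0.
Proof. by move=> /(single X)[Y YX _]; exists (\sum_j kobayashi_royden D z (Y j)), Y. Qed.

(** Subadditivity: nearly optimal decompositions of two vectors are juxtaposed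
and shortened back to [m] terms. *)
Let kobayashi_seminorm m : (0 < m)%N -> (2 * n <= m.+1)%N -> seminorm (kobayashi m D z).
Proof.
move=> m0 nm; have bk := kobayashi_royden_balanced; have [k0 kZ] := bk.
have p0 X : 0 <= kobayashi m D z X.
  apply: lb_le_inf; first exact: sums_neq0.
  by move=> _ [Y _ <-]; exact: sumr_ge0.
have approx X (e : R) : 0 < e -> exists2 Y : 'I_m -> V, \sum_j Y j = X &
    \sum_j kobayashi_royden D z (Y j) < kobayashi m D z X + e.
  move=> e0; have [|_ [Y YX <-] Ye] := @inf_adherent R (sums m X) e e0.
    by split; [exact: sums_neq0|exact: sums_lb].
  by exists Y.
have ple (u : Cplx R) X : kobayashi m D z (u *: X) <= modulus u * kobayashi m D z X.
  have [->|u0] := eqVneq u 0.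
    rewrite scale0r modulus0 mul0r.
    have [Y Y0 kY] := single 0 m0.
    by rewrite -Y0 (le_trans (kobayashi_le _))// kY balanced0.
  rewrite -ler_pdivrMl ?modulus_gt0//; apply: lb_le_inf; first exact: sums_neq0.
  move=> _ [Y YX <-]; rewrite ler_pdivrMl ?modulus_gt0//.
  rewrite -YX scaler_sumr (le_trans (kobayashi_le _))//.
  by rewrite mulr_sumr; apply: ler_sum => j _; rewrite kZ.
split=> // [u X|X X'].
  rewrite -/(modulus u); apply/eqP; rewrite eq_le ple/=.
  have [->|u0] := eqVneq u 0; first by rewrite modulus0 mul0r.
  rewrite -ler_pdivlMl ?modulus_gt0// -modulusV.
  by have := ple u^-1 (u *: X); rewrite scalerA mulVf// scale1r.
suff H (e : R) : 0 < e -> kobayashi m D z (X + X') <= e + (kobayashi m D z X + kobayashi m D z X').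
  exact/ler_addgt0Pl.
move=> e0; have e3 : 0 < e / 3 by rewrite divr_gt0.
have [Y YX kY] := approx X _ e3; have [Y' YX' kY'] := approx X' _ e3.
pose Z (i : 'I_(m + m)) := match fintype.split i with inl j => Y j | inr j => Y' j end.
have splitZ (W : nmodType) (f : V -> W) :
    \sum_i f (Z i) = \sum_j f (Y j) + \sum_j f (Y' j).
  rewrite big_split_ord/=; congr (_ + _); apply: eq_bigr => j _; rewrite /Z.
    by rewrite (unsplitK (inl j)).
  by rewrite (unsplitK (inr j)).
have [T [TZ kT]] := balanced_reduce Z bk nm e3.
rewrite -YX -YX' -(splitZ _ id) -TZ (le_trans (kobayashi_le _))//.
rewrite (le_trans kT)// splitZ YX YX'; lra.
Qed.

Lemma kobayashi_eq_buseman m X : (0 < m)%N -> (2 * n <= m.+1)%N ->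
  kobayashi m D z X = kobayashi_buseman D z X.
Proof.
move=> m0 nm; have [[sb kb] lb] := kobayashi_buseman_largest D z.
apply/eqP; rewrite eq_le; apply/andP; split.
  apply: lb; split; first exact: kobayashi_seminorm.
  by move=> Y; have [Z <- <-] := single Y m0; exact: kobayashi_le.
apply: lb_le_inf; first exact: sums_neq0.
move=> _ [Y YX <-]; rewrite -YX (le_trans (seminorm_sum _ sb))//.
by apply: ler_sum => j _; exact: kb.
Qed.

End KobayashiSeminorm.

Theorem theorem1 (R : realType) :
  (forall (n : nat) (D : set 'rV[Cplx R]_n),
     (1 <= n)%N -> domain D ->
     forall z X : 'rV[Cplx R]_n, D z ->
       kobayashi (2 * n - 1) D z X = kobayashi_buseman D z X) /\
  (forall n : nat, (2 <= n.+1)%N ->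
     kobayashi (2 * n.+1 - 2) (@Dn R n) 0 <> kobayashi_buseman (@Dn R n) 0).
Proof.
split=> [n D n1 _ z X Dz|n n2].
  by apply: kobayashi_eq_buseman => //; lia.
rewrite (_ : (2 * n.+1 - 2 = 2 * n)%N); last by lia.
exact: kobayashi_Dn_neq_buseman.
Qed.
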